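(* For any prime $p>2$ and any field $k$ of characteristic $p$, the $T$-space $CP(G_0)$ of $k_0\langle X\rangle$, where $G_0$ is the infinite dimensional nonunitary Grassmann algebra over $k$, is not finitely based.
   Context: $X=\{x_i\mid i\ge 0\}$ is a countably infinite set and $k_0\langle X\rangle$ is the free (nonunitary) associative $k$-algebra on $X$. A $T$-space of $k_0\langle X\rangle$ is a linear subspace of $k_0\langle X\rangle$ invariant under every $k$-algebra endomorphism of $k_0\langle X\rangle$. For a subset $H$, the $T$-space generated by $H$ is the smallest $T$-space containing $H$. A $T$-space is finitely based if it is the $T$-space generated by some finite subset. The infinite dimensional nonunitary Grassmann algebra $G_0$ over $k$ is the associative algebra generated by $e_i$, $i\ge1$, with $e_ie_j=-e_je_i$ and $e_i^2=0$ for all $i,j$, having linear basis $\{e_{i_1}e_{i_2}\cdots e_{i_n}\mid n\ge1,\ i_1<i_2<\cdots<i_n\}$. For a $k$-algebra $A$, $T(A)$ is the set of all $f\in k_0\langle X\rangle$ lying in the kernel of every algebra homomorphism $k_0\langle X\rangle\to A$. A central polynomial of $A$ is an element $f\in k_0\langle X\rangle$ with $f\notin T(A)$ whose image under every homomorphism $k_0\langle X\rangle\to A$ lies in the centre of $A$. $CP(A)$ is the $T$-space of $k_0\langle X\rangle$ generated by the set of all central polynomials of $A$. *)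

(* Defs.v *)
From HB Require Import structures.
From mathcomp Require Import all_boot all_order all_algebra.
From mathcomp Require Import finmap.
From mathcomp.multinomials Require Import monalg.

Set Implicit Arguments.
Unset Strict Implicit.
Unset Printing Implicit Defensive.

Import GRing.Theory.
Local Open Scope ring_scope.

(* MathComp's algType is unitary; associative algebras without a unit are      *)
(* introduced here as modules with an associative bilinear product.            *)
HB.mixin Record Lmodule_isNonUnitalAlg (k : nzRingType) V
    of GRing.Lmodule k V := {
  nmul : V -> V -> V;
  nmulA : associative nmul;
  nmul_linearl : forall (c : k) (x y z : V),
    nmul (c *: x + y) z = c *: nmul x z + nmul y z;
  nmul_linearr : forall (c : k) (x y z : V),
    nmul x (c *: y + z) = c *: nmul x y + nmul x z
}.

#[short(type="nonUnitalAlgType")]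
HB.structure Definition NonUnitalAlg (k : nzRingType) :=
  { V of Lmodule_isNonUnitalAlg k V & GRing.Lmodule k V }.

Definition alg_hom (k : nzRingType) (A B : nonUnitalAlgType k)
    (phi : A -> B) : Prop :=
  linear phi /\ {morph phi : x y / nmul x y}.

Definition central (k : nzRingType) (A : nonUnitalAlgType k) (z : A) : Prop :=
  forall a : A, nmul z a = nmul a z.

(* The module with basis K, with product determined by                         *)
(*   << x >> * << y >> = c x y *: << op x y >>.                                *)
(* Both algebras below have this form.                                         *)
HB.lock Definition twisted_mul (k : comNzRingType) (K : choiceType)
    (op : K -> K -> K) (c : K -> K -> k) (f g : {malg k[K]}) : {malg k[K]} :=
  \sum_(x <- msupp f) \sum_(y <- msupp g) << c x y * f@_x * g@_y *g op x y >>.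

Section TwistedProduct.
Variables (k : comNzRingType) (K : choiceType).
Variables (op : K -> K -> K) (c : K -> K -> k).

Local Notation twisted_mul := (@twisted_mul k K op c).

Lemma twisted_mulwl (d1 d2 : {fset K}) f g :
    (msupp f `<=` d1)%fset -> (msupp g `<=` d2)%fset ->
  twisted_mul f g =
    \sum_(x <- d1) \sum_(y <- d2) << c x y * f@_x * g@_y *g op x y >>.
Proof.
move=> le1 le2; rewrite unlock (big_fset_incl _ le1) /=; last first.
  move=> x _ /mcoeff_outdom fx0; rewrite big1 // => y _.
  by rewrite fx0 mulr0 mul0r monalgU0.
apply: eq_bigr => x _; rewrite (big_fset_incl _ le2) //= => y _.
by move=> /mcoeff_outdom gy0; rewrite gy0 mulr0 monalgU0.
Qed.

Lemma malgZU (a b : k) (x : K) : a *: << b *g x >> = << a * b *g x >>.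
Proof. by apply/malgP => y; rewrite mcoeffZ !mcoeffU -mulrnAr. Qed.

Lemma twisted_mul_linearl (a : k) (f g h : {malg k[K]}) :
  twisted_mul (a *: f + g) h = a *: twisted_mul f h + twisted_mul g h.
Proof.
have lefg : (msupp (a *: f + g) `<=` msupp f `|` msupp g)%fset.
  apply: fsubset_trans (msuppD_le _ _) _.
  by apply: fsetUSS; [exact: msuppZ_le | exact: fsubset_refl].
rewrite (twisted_mulwl lefg (fsubset_refl _)).
rewrite (twisted_mulwl (fsubsetUl _ (msupp g)) (fsubset_refl _)).
rewrite (twisted_mulwl (fsubsetUr (msupp f) _) (fsubset_refl _)).
rewrite scaler_sumr -big_split /=; apply: eq_bigr => x _.
rewrite scaler_sumr -big_split /=; apply: eq_bigr => y _.
rewrite malgZU -monalgUD mcoeffD mcoeffZ mulrDr mulrDl.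
by rewrite !mulrA [c x y * a]mulrC.
Qed.

Lemma twisted_mul_linearr (a : k) (f g h : {malg k[K]}) :
  twisted_mul f (a *: g + h) = a *: twisted_mul f g + twisted_mul f h.
Proof.
have legh : (msupp (a *: g + h) `<=` msupp g `|` msupp h)%fset.
  apply: fsubset_trans (msuppD_le _ _) _.
  by apply: fsetUSS; [exact: msuppZ_le | exact: fsubset_refl].
rewrite (twisted_mulwl (fsubset_refl _) legh).
rewrite (twisted_mulwl (fsubset_refl _) (fsubsetUl _ (msupp h))).
rewrite (twisted_mulwl (fsubset_refl _) (fsubsetUr (msupp g) _)).
rewrite scaler_sumr -big_split /=; apply: eq_bigr => x _.
rewrite scaler_sumr -big_split /=; apply: eq_bigr => y _.
rewrite malgZU -monalgUD mcoeffD mcoeffZ mulrDr.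
by rewrite !mulrA [_ * a]mulrC !mulrA.
Qed.

Lemma twisted_mulUU (a b : k) (x y : K) :
  twisted_mul << a *g x >> << b *g y >> = << c x y * a * b *g op x y >>.
Proof.
rewrite (twisted_mulwl msuppU_le msuppU_le) !big_seq_fset1.
by rewrite !mcoeffUU.
Qed.

Lemma malg_linear_ind (P : {malg k[K]} -> Prop) :
    P 0 -> (forall a f g, P f -> P g -> P (a *: f + g)) ->
    (forall x, P << x >>) -> forall f, P f.
Proof.
move=> P0 PD PU f; rewrite (monalgE f).
elim/big_rec: _ => // x g _ Pg.
have -> : << f@_x *g x >> = f@_x *: << x >> by rewrite malgZU mulr1.
exact: PD.
Qed.

Hypothesis opA : associative op.
Hypothesis c_cocycle : forall x y z, c y z * c x (op y z) = c x y * c (op x y) z.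

Lemma twisted_mulA : associative twisted_mul.
Proof.
have mul0l f : twisted_mul 0 f = 0.
  by rewrite unlock msupp0 big_seq_fset0.
have mul0r f : twisted_mul f 0 = 0.
  by rewrite unlock msupp0 big1 // => x _; rewrite big_seq_fset0.
move=> f g h; elim/malg_linear_ind: f => [|a f1 f2 IH1 IH2|x].
- by rewrite !mul0l.
- by rewrite !twisted_mul_linearl IH1 IH2.
elim/malg_linear_ind: g => [|a g1 g2 IH1 IH2|y].
- by rewrite !(mul0l, mul0r).
- by rewrite !(twisted_mul_linearl, twisted_mul_linearr) IH1 IH2.
elim/malg_linear_ind: h => [|a h1 h2 IH1 IH2|z].
- by rewrite !mul0r.
- by rewrite !twisted_mul_linearr IH1 IH2.
rewrite !twisted_mulUU !mulr1 opA; congr << _ *g _ >>.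
by rewrite mulrC c_cocycle mulrC.
Qed.

End TwistedProduct.

(* k_0<X>: the basis is the free semigroup on X = {x_i | i >= 0}, that is, the *)
(* nonempty words in the indices.                                              *)
Definition word := {w : seq nat | w != [::]}.

Lemma word_cat_neq0 (u v : word) : val u ++ val v != [::].
Proof. by case: u => -[]. Qed.

Definition word_cat (u v : word) : word := Sub (val u ++ val v) (word_cat_neq0 u v).

Lemma word_catA : associative word_cat.
Proof. by move=> u v w; apply: val_inj; rewrite /= catA. Qed.

Definition freeAlg (k : comNzRingType) := {malg k[word]}.
HB.instance Definition _ (k : comNzRingType) := GRing.Lmodule.copy (freeAlg k) {malg k[word]}.

Definition free_mul (k : comNzRingType) : freeAlg k -> freeAlg k -> freeAlg k :=
  twisted_mul word_cat (fun _ _ => 1).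

Lemma free_mulA (k : comNzRingType) : associative (@free_mul k).
Proof. exact: (twisted_mulA word_catA). Qed.

HB.instance Definition _ (k : comNzRingType) :=
  Lmodule_isNonUnitalAlg.Build k (freeAlg k) (@free_mulA k)
    (@twisted_mul_linearl k word word_cat _)
    (@twisted_mul_linearr k word word_cat _).

Lemma free_mulUU (k : comNzRingType) (a b : k) (u v : word) :
  nmul (<< a *g u >> : freeAlg k) << b *g v >> = << a * b *g word_cat u v >>.
Proof. by rewrite [LHS]twisted_mulUU mul1r. Qed.

(* G_0: the basis element e_(i_1) ... e_(i_n), i_1 < ... < i_n, n >= 1, is     *)
(* indexed by the nonempty finite set {i_1, ..., i_n}. The generators are      *)
(* numbered from 0 here.                                                       *)
Definition monomG := {A : {fset nat} | A != fset0}.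

Lemma monomG_U_neq0 (A B : monomG) : (val A `|` val B)%fset != fset0.
Proof. by rewrite fsetU_eq0 negb_and (valP A). Qed.

Definition monomG_U (A B : monomG) : monomG :=
  Sub (val A `|` val B)%fset (monomG_U_neq0 A B).

Lemma monomG_UA : associative monomG_U.
Proof. by move=> A B C; apply: val_inj; rewrite /= fsetUA. Qed.

(* The number of transpositions which sort the concatenation of the increasing *)
(* enumerations of A and B.                                                    *)
Definition inversions (A B : {fset nat}) : nat :=
  (\sum_(a <- A) \sum_(b <- B) (b < a)%N)%N.

(* e_A * e_B = +/- e_(A U B), and 0 when some e_i occurs twice. *)
Definition signG (k : comNzRingType) (A B : monomG) : k :=
  if [disjoint val A & val B]%fset then (-1) ^+ inversions (val A) (val B) else 0.

Lemma sum_fsetU (A B : {fset nat}) (F : nat -> nat) : [disjoint A & B]%fset ->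
  (\sum_(a <- (A `|` B)%fset) F a = \sum_(a <- A) F a + \sum_(a <- B) F a)%N.
Proof.
move=> dAB; rewrite (big_fsetID _ (mem A)) /=; congr (_ + _)%N; congr bigop.
  congr enum_fset; apply/fsetP => x; rewrite !inE /=.
  by case: (x \in A); rewrite ?andbF.
congr enum_fset; apply/fsetP => x; rewrite !inE /=.
case: (boolP (x \in A)) => [xA|_]; last by rewrite andbT.
by rewrite andbF; apply/esym/negbTE/(fdisjointP dAB).
Qed.

Lemma inversionsUl (A B C : {fset nat}) : [disjoint A & B]%fset ->
  inversions (A `|` B)%fset C = (inversions A C + inversions B C)%N.
Proof. by move=> dAB; rewrite /inversions sum_fsetU. Qed.

Lemma inversionsUr (A B C : {fset nat}) : [disjoint B & C]%fset ->
  inversions A (B `|` C)%fset = (inversions A B + inversions A C)%N.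
Proof.
move=> dBC; rewrite /inversions -big_split /=; apply: eq_bigr => a _.
by rewrite sum_fsetU.
Qed.

Lemma signG_cocycle (k : comNzRingType) (A B C : monomG) :
  signG k B C * signG k A (monomG_U B C) = signG k A B * signG k (monomG_U A B) C.
Proof.
rewrite /signG /= fdisjointXU fdisjointUX.
case: (boolP [disjoint val A & val B]%fset) => [dAB|_];
  case: (boolP [disjoint val A & val C]%fset) => [dAC|_];
  case: (boolP [disjoint val B & val C]%fset) => [dBC|_] /=;
  rewrite ?(mul0r, mulr0) //.
rewrite inversionsUl // inversionsUr // -!exprD.
by congr (_ ^+ _); rewrite addnC -addnA.
Qed.

Definition grassmann0 (k : comNzRingType) := {malg k[monomG]}.
HB.instance Definition _ (k : comNzRingType) := GRing.Lmodule.copy (grassmann0 k) {malg k[monomG]}.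

Definition grassmann_mul (k : comNzRingType) :
    grassmann0 k -> grassmann0 k -> grassmann0 k :=
  twisted_mul monomG_U (signG k).

Lemma grassmann_mulA (k : comNzRingType) : associative (@grassmann_mul k).
Proof. exact: (twisted_mulA monomG_UA (@signG_cocycle k)). Qed.

HB.instance Definition _ (k : comNzRingType) :=
  Lmodule_isNonUnitalAlg.Build k (grassmann0 k) (@grassmann_mulA k)
    (@twisted_mul_linearl k monomG monomG_U _)
    (@twisted_mul_linearr k monomG monomG_U _).

Lemma grassmann_mulUU (k : comNzRingType) (a b : k) (A B : monomG) :
  nmul (<< a *g A >> : grassmann0 k) << b *g B >>
    = << signG k A B * a * b *g monomG_U A B >>.
Proof. exact: twisted_mulUU. Qed.

Section GrassmannRelations.
Variable k : comNzRingType.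

Lemma fset1_neq0 (i : nat) : [fset i]%fset != fset0.
Proof. by apply/fset0Pn; exists i; rewrite in_fset1. Qed.

Definition genG (i : nat) : grassmann0 k := << (Sub [fset i]%fset (fset1_neq0 i) : monomG) >>.

Lemma genG_sqr (i : nat) : nmul (genG i) (genG i) = 0.
Proof.
rewrite grassmann_mulUU !mulr1 /signG /= fdisjoint1X in_fset1 eqxx /=.
exact: monalgU0.
Qed.

Lemma genG_anticomm (i j : nat) : nmul (genG i) (genG j) = - nmul (genG j) (genG i).
Proof.
have [->|neq_ij] := eqVneq i j; first by rewrite genG_sqr oppr0.
rewrite /genG; have := @monalgUN monomG k; have := @grassmann_mulUU k.
(* abstracted because comparing distinct monomials by conversion is very slow *)
move: (@mkmalgU monomG k) => m mM mN; rewrite !mM -mN !mulr1.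
congr (m _ _); first by apply: val_inj; rewrite /= fsetUC.
rewrite /signG /= !fdisjoint1X !in_fset1 [j == i]eq_sym neq_ij.
rewrite /inversions !big_seq_fset1.
by case: (ltngtP i j) neq_ij => //= _ _; rewrite ?expr0 ?expr1 ?opprK.
Qed.

Lemma genG_monom (A : monomG) (i : nat) : (forall a, a \in val A -> (a < i)%N) ->
  nmul (<< A >> : grassmann0 k) (genG i)
    = << monomG_U A (Sub [fset i]%fset (fset1_neq0 i)) >>.
Proof.
move=> ltAi; rewrite grassmann_mulUU !mulr1.
suff -> : signG k A (Sub [fset i]%fset (fset1_neq0 i)) = 1 by [].
rewrite /signG /= fdisjointX1.
case: (boolP (i \in _)) => [/ltAi|_ /=]; first by rewrite ltnn.
rewrite /inversions big_seq big1 ?expr0 // => a /ltAi lt_ai.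
by rewrite big_seq_fset1 ltnNge (ltnW lt_ai).
Qed.

End GrassmannRelations.

Section TSpaces.
Variable k : fieldType.

Definition T_space (S : freeAlg k -> Prop) : Prop :=
  [/\ S 0,
      forall (a : k) (f g : freeAlg k), S f -> S g -> S (a *: f + g)
    & forall phi : freeAlg k -> freeAlg k, alg_hom phi -> forall f, S f -> S (phi f)].

Definition T_space_gen (H : freeAlg k -> Prop) (f : freeAlg k) : Prop :=
  forall S, T_space S -> (forall h, H h -> S h) -> S f.

Definition finitely_based (S : freeAlg k -> Prop) : Prop :=
  exists H : seq (freeAlg k), forall f, S f <-> T_space_gen (fun h => h \in H) f.

Variable A : nonUnitalAlgType k.

Definition T_ideal (f : freeAlg k) : Prop :=
  forall phi : freeAlg k -> A, alg_hom phi -> phi f = 0.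

Definition central_polynomial (f : freeAlg k) : Prop :=
  ~ T_ideal f /\ forall phi : freeAlg k -> A, alg_hom phi -> central (phi f).

Definition CP : freeAlg k -> Prop := T_space_gen central_polynomial.

End TSpaces.

(* Main.v *)
Require Import Defs.
From mathcomp Require Import all_boot all_order all_algebra.
From HB Require Import structures.
From mathcomp Require Import finmap zify.
From mathcomp.multinomials Require Import monalg.

(* Modulo T(G_0), k_0<X> embeds into the algebra of differential
   forms k[a_i]/(a_i^p) (x) Lambda(b_i), b_i = d a_i, by x_i |-> a_i + b_i, and
   its image consists of sums w + dw with w even of positive degree (the product
   of such sums corresponds to Fedosov's u * v = uv + du dv). Since the centre of
   G_0 is its even part, f is in CP(G_0) iff dw = 0. An Euler homotopy shows that
   closed forms are, modulo exact ones, spanned by products of the forms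
   a_i^(p-1) b_i. An endomorphism of k_0<X> substitutes even forms u for the a_i
   and du for the b_i, and by Cartier's formula u^(p-1) du is, modulo exact
   forms, a linear combination of the a_j^(p-1) b_j. Hence, when f in CP(G_0)
   involves fewer than n variables, the coefficient of the product of the
   a_j^(p-1) b_j, j < n, vanishes in every endomorphic image of f. For n = 2N
   it does not vanish in the image of the central polynomial
   prod_(i < N) x_(2i)^(p-1) [x_(2i), x_(2i+1)] x_(2i+1)^(p-1). *)

Set Implicit Arguments.
Unset Strict Implicit.
Unset Printing Implicit Defensive.

Import GRing.Theory.
Local Open Scope ring_scope.

(** * Unitization and evaluation of noncommutative polynomials *)

(** The invariant sees all endomorphisms at once: the members of CP(G_0) whose endomorphic images
    all have top coefficient 0 form a T-space, so only the finitely many generators have to be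
    tested. The top coefficient vanishes on exact forms, because a primitive would need a factor
    a_i^p = 0. A product of at most m Cartier forms is, modulo exact forms, of degree at most m in
    the b_j, so for m < n it misses the top monomial. The truncation a_i^p = 0 fits G_0, where even
    elements have p-th power 0 in characteristic p. Faithfulness of the map from forms to G_0 is
    needed only at the top monomial: multiplication by a complementary monomial moves any nonzero
    odd form there. This test for centrality works for an even number of variables, because the
    complement of an odd monomial must again be odd; hence the numbers 2b and 2(b + 1) at the end.
    That p is odd enters through the invertibility of 2, both in this test and in the coefficient
    2^N of the witness. *)

Section NonUnitalAlgTheory.
Variables (k : nzRingType) (A : nonUnitalAlgType k).

Lemma nmulDl (x y z : A) : nmul (x + y) z = nmul x z + nmul y z.
Proof. by have := nmul_linearl 1 x y z; rewrite !scale1r. Qed.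

Lemma nmulDr (x y z : A) : nmul z (x + y) = nmul z x + nmul z y.
Proof. by have := nmul_linearr 1 z x y; rewrite !scale1r. Qed.

Lemma nmul0l (z : A) : nmul 0 z = 0.
Proof. by apply: (addrI (nmul 0 z)); rewrite -nmulDl !addr0. Qed.

Lemma nmul0r (z : A) : nmul z 0 = 0.
Proof. by apply: (addrI (nmul z 0)); rewrite -nmulDr !addr0. Qed.

Lemma nmulZl (c : k) (x z : A) : nmul (c *: x) z = c *: nmul x z.
Proof. by have := nmul_linearl c x 0 z; rewrite !addr0 nmul0l addr0. Qed.

Lemma nmulZr (c : k) (x z : A) : nmul z (c *: x) = c *: nmul z x.
Proof. by have := nmul_linearr c z x 0; rewrite !addr0 nmul0r addr0. Qed.

End NonUnitalAlgTheory.

(** Forms have a unit and G_0 has none, and powers and empty products need one. Evaluations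
    therefore take values in unital algebras, with [A] recovered as the kernel of the first
    coordinate. *)
Definition unitized (k : comNzRingType) (A : nonUnitalAlgType k) : Type :=
  (k^o * A)%type.

Section Unitization.
Variables (k : comNzRingType) (A : nonUnitalAlgType k).

HB.instance Definition _ := GRing.Lmodule.copy (unitized A) (k^o * A)%type.

Implicit Types x y z : unitized A.

Definition unitized_mul x y : unitized A :=
  (x.1 * y.1, x.1 *: y.2 + y.1 *: x.2 + nmul x.2 y.2).

Lemma unitized_mulA : associative unitized_mul.
Proof.
move=> x y z; rewrite /unitized_mul /=; congr (_, _); first exact: mulrA.
rewrite !(nmulDl, nmulDr, nmulZl, nmulZr, scalerDr, scalerA) nmulA !addrA.
rewrite (mulrC z.1 x.1) (mulrC z.1 y.1); congr (_ + _).
rewrite -!addrA; congr (_ + (_ + _)); rewrite !addrA.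
by rewrite [RHS](ACl (3*1*4*2)%AC).
Qed.

Lemma unitized_mul1l : left_id ((1, 0) : unitized A) unitized_mul.
Proof.
by case=> a x; rewrite /unitized_mul /= mul1r scale1r scaler0 nmul0l !addr0.
Qed.

Lemma unitized_mul1r : right_id ((1, 0) : unitized A) unitized_mul.
Proof.
by case=> a x; rewrite /unitized_mul /= mulr1 scale1r scaler0 nmul0r add0r addr0.
Qed.

Lemma unitized_mulDl : left_distributive unitized_mul +%R.
Proof.
move=> x y z; rewrite /unitized_mul; congr (_, _) => /=; first by rewrite mulrDl.
by rewrite nmulDl scalerDl scalerDr [RHS](AC (3*3) ((1*4)*(2*5)*(3*6))%AC).
Qed.

Lemma unitized_mulDr : right_distributive unitized_mul +%R.
Proof.
move=> x y z; rewrite /unitized_mul; congr (_, _) => /=; first by rewrite mulrDr.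
by rewrite nmulDr scalerDl scalerDr [RHS](AC (3*3) ((1*4)*(2*5)*(3*6))%AC).
Qed.

Lemma unitized_1neq0 : ((1, 0) : unitized A) != 0.
Proof. by apply/eqP => -[] /eqP; rewrite oner_eq0. Qed.

HB.instance Definition _ := GRing.Zmodule_isNzRing.Build (unitized A)
  unitized_mulA unitized_mul1l unitized_mul1r unitized_mulDl unitized_mulDr
  unitized_1neq0.

Lemma unitized_scalerAl (c : k) x y : c *: (x * y) = (c *: x) * y.
Proof.
congr (_, _) => /=; first exact: mulrA.
by rewrite !scalerDr nmulZl !scalerA (mulrC c y.1).
Qed.

HB.instance Definition _ :=
  GRing.Lmodule_isLalgebra.Build k (unitized A) unitized_scalerAl.

Lemma unitized_scalerAr (c : k) x y : c *: (x * y) = x * (c *: y).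
Proof.
congr (_, _) => /=; first exact: mulrCA.
by rewrite !scalerDr nmulZr !scalerA (mulrC c x.1).
Qed.

HB.instance Definition _ :=
  GRing.Lalgebra_isAlgebra.Build k (unitized A) unitized_scalerAr.

Definition inU (a : A) : unitized A := (0, a).

Lemma inU_linear : linear inU.
Proof. by move=> c x y; congr (_, _); rewrite /= scaler0 addr0. Qed.

HB.instance Definition _ := GRing.isLinear.Build k A (unitized A) _ inU inU_linear.

Lemma inU_M a b : inU (nmul a b) = inU a * inU b.
Proof. by congr (_, _) => /=; rewrite ?mulr0 // !scale0r !add0r. Qed.

Lemma inU_inj : injective inU.
Proof. by move=> a b []. Qed.

Lemma unitizedE x : x = x.1 *: 1 + inU x.2.
Proof.
by case: x => c a; congr (_, _); rewrite /= ?scaler0 ?add0r // addr0 [RHS]mulr1.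
Qed.

Lemma fst_eq0P (c : k) x y : x.1 = 0 -> y.1 = 0 -> (c *: x + y).1 = 0.
Proof. by move=> /= -> ->; rewrite scaler0 addr0. Qed.

Lemma fst_eq0D x y : x.1 = 0 -> y.1 = 0 -> (x + y).1 = 0.
Proof. by move=> /= -> ->; rewrite addr0. Qed.

Lemma fst_eq0M x y : x.1 = 0 -> (x * y).1 = 0.
Proof. by move=> /= ->; rewrite mul0r. Qed.

Lemma fst_unitizedM x y : (x * y).1 = x.1 * y.1.
Proof. by []. Qed.

Lemma fst_unitizedX x m : (x ^+ m).1 = x.1 ^+ m.
Proof. by elim: m => [|m IHm] //; rewrite !exprS fst_unitizedM IHm. Qed.

Lemma unitized_commutator x y :
  x * y - y * x = inU (nmul x.2 y.2 - nmul y.2 x.2).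
Proof.
congr (_, _) => /=; first by rewrite mulrC subrr.
by rewrite [y.1 *: x.2 + _]addrC opprD addrACA subrr add0r.
Qed.

Lemma inU_comm a x : nmul a x.2 = nmul x.2 a -> GRing.comm (inU a) x.
Proof.
move=> ax; rewrite (unitizedE x); apply: commrD; last by rewrite /GRing.comm -!inU_M ax.
by rewrite /GRing.comm mulr_algl mulr_algr.
Qed.

Lemma inU_anticomm a b : nmul a b = - nmul b a -> inU a * inU b = - (inU b * inU a).
Proof. by move=> ab; rewrite -!inU_M ab linearN. Qed.

Lemma inU_sqr0 a : nmul a a = 0 -> inU a * inU a = 0.
Proof. by move=> aa; rewrite -inU_M aa linear0. Qed.

Lemma inU_snd x : x.1 = 0 -> inU x.2 = x.
Proof. by case: x => c a /= ->. Qed.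

End Unitization.

Section UnitizationMorphism.
Variables (k : comNzRingType) (A : nonUnitalAlgType k) (T : algType k).
Variable phi : A -> T.
Hypothesis phi_lin : linear phi.
Hypothesis phiM : forall a b, phi (nmul a b) = phi a * phi b.

(** The unital extension of [phi]; it transports [witness], which is assembled in a unitization, to
    other algebras. *)
Definition unitized_map (x : unitized A) : T := x.1 *: 1 + phi x.2.

Lemma unitized_map_linear : linear unitized_map.
Proof.
move=> c x y; rewrite /unitized_map /= phi_lin scalerDl !scalerDr -scalerA.
by rewrite addrACA.
Qed.

Lemma unitized_map_monoid : monoid_morphism unitized_map.
Proof.
have phi0 : phi 0 = 0 by have := phi_lin (- 1) 0 0; rewrite scaleN1r addr0 oppr0 scaleN1r addNr.
have phiD a b : phi (a + b) = phi a + phi b.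
  by have := phi_lin 1 a b; rewrite !scale1r.
have phiZ c a : phi (c *: a) = c *: phi a by have := phi_lin c a 0; rewrite phi0 !addr0.
split=> [|x y]; rewrite /unitized_map /=; first by rewrite scale1r phi0 addr0.
rewrite !phiD !phiZ phiM mulrDl !mulrDr -!scalerAl -!scalerAr !mulr1 !mul1r.
by rewrite scalerA !addrA.
Qed.

Lemma unitized_map_inU a : unitized_map (inU a) = phi a.
Proof. by rewrite /unitized_map /= scale0r add0r. Qed.

End UnitizationMorphism.

(* Locked because comparing distinct words by conversion is very slow. *)
HB.lock Definition wordU (k : comNzRingType) (w : word) : freeAlg k := << w >>.

Definition word1 (i : nat) : word := Sub [:: i] isT.

Section FreeEvaluation.
Variables (k : comNzRingType) (T : algType k).

Lemma wordU_cat (u v : word) : wordU k (word_cat u v) = nmul (wordU k u) (wordU k v).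
Proof. by rewrite unlock; have := @free_mulUU k 1 1 u v; rewrite mulr1. Qed.

Lemma freeAlg_linear_ind (P : freeAlg k -> Prop) :
    P 0 -> (forall a f g, P f -> P g -> P (a *: f + g)) ->
    (forall w : word, P (wordU k w)) -> forall f, P f.
Proof.
by move=> P0 PD PU; apply: malg_linear_ind => // w; have := PU w; rewrite unlock.
Qed.

Definition word_eval (t : nat -> T) (w : word) : T := \prod_(i <- val w) t i.

Definition free_eval (t : nat -> T) (f : freeAlg k) : T :=
  \sum_(w <- msupp f) f@_w *: word_eval t w.

Lemma free_evalEw t (d : {fset word}) f : (msupp f `<=` d)%fset ->
  free_eval t f = \sum_(w <- d) f@_w *: word_eval t w.
Proof.
move=> le_fd; rewrite /free_eval (big_fset_incl _ le_fd) //= => w _.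
by move=> /mcoeff_outdom ->; rewrite scale0r.
Qed.

Lemma free_eval_linear t : linear (free_eval t).
Proof.
move=> c f g.
have lefg : (msupp (c *: f + g) `<=` msupp f `|` msupp g)%fset.
  apply: fsubset_trans (msuppD_le _ _) _.
  by apply: fsetUSS; [exact: msuppZ_le | exact: fsubset_refl].
rewrite (free_evalEw _ lefg) (free_evalEw _ (fsubsetUl _ (msupp g))).
rewrite (free_evalEw _ (fsubsetUr (msupp f) _)) scaler_sumr -big_split /=.
by apply: eq_bigr => w _; rewrite mcoeffD mcoeffZ scalerDl scalerA.
Qed.

HB.instance Definition _ t := GRing.isLinear.Build k (freeAlg k) T _ (free_eval t)
  (free_eval_linear t).

Lemma free_evalU t (w : word) : free_eval t (wordU k w) = word_eval t w.
Proof. by rewrite unlock (free_evalEw _ msuppU_le) big_seq_fset1 mcoeffUU scale1r. Qed.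

Lemma free_evalM t f g : free_eval t (nmul f g) = free_eval t f * free_eval t g.
Proof.
elim/freeAlg_linear_ind: f => [|a f1 f2 IH1 IH2|u].
- by rewrite nmul0l linear0 mul0r.
- by rewrite nmul_linearl !linearP /= IH1 IH2 mulrDl scalerAl.
elim/freeAlg_linear_ind: g => [|a g1 g2 IH1 IH2|v].
- by rewrite nmul0r linear0 mulr0.
- by rewrite nmul_linearr !linearP /= IH1 IH2 mulrDr scalerAr.
by rewrite -wordU_cat !free_evalU /word_eval big_cat.
Qed.

Lemma eq_in_free_eval t t' (f : freeAlg k) :
    (forall (w : word) i, w \in msupp f -> i \in val w -> t i = t' i) ->
  free_eval t f = free_eval t' f.
Proof.
move=> eqt; rewrite /free_eval big_seq [RHS]big_seq; apply: eq_bigr => w wf.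
by congr (_ *: _); rewrite /word_eval big_seq [RHS]big_seq; apply: eq_bigr => i /(eqt _ _ wf).
Qed.

Definition varX (i : nat) : freeAlg k := wordU k (word1 i).

Lemma free_eval_varX t i : free_eval t (varX i) = t i.
Proof. by rewrite free_evalU /word_eval /= big_seq1. Qed.

Lemma word_ind (P : word -> Prop) : (forall i, P (word1 i)) ->
  (forall i w, P w -> P (word_cat (word1 i) w)) -> forall w, P w.
Proof.
move=> P1 PS [[//|i s] ws]; elim: s i ws => [|j s IHs] i ws.
  by rewrite (_ : exist _ _ _ = word1 i) //; apply: val_inj.
rewrite (_ : exist _ _ _ = word_cat (word1 i) (Sub (j :: s) isT)); last exact: val_inj.
by apply: PS; apply: IHs.
Qed.

Lemma freeAlg_ind (P : freeAlg k -> Prop) :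
    P 0 -> (forall a f g, P f -> P g -> P (a *: f + g)) ->
    (forall i, P (varX i)) -> (forall f g, P f -> P g -> P (nmul f g)) ->
  forall f, P f.
Proof.
move=> P0 PD PX PM; elim/freeAlg_linear_ind => //; elim/word_ind => // i w Pw.
by rewrite wordU_cat; apply: PM => //; apply: PX.
Qed.

Lemma free_eval_unique (h h' : freeAlg k -> T) :
    linear h -> (forall f g, h (nmul f g) = h f * h g) ->
    linear h' -> (forall f g, h' (nmul f g) = h' f * h' g) ->
    (forall i, h (varX i) = h' (varX i)) ->
  h =1 h'.
Proof.
move=> hL hM h'L h'M eqX; elim/freeAlg_ind => [|a f g IHf IHg||f g IHf IHg].
- have h0 (u : freeAlg k -> T) : linear u -> u 0 = 0.
    by move=> uL; have := uL (- 1) 0 0; rewrite scaleN1r addr0 oppr0 scaleN1r addNr.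
  by rewrite !h0.
- by rewrite hL h'L IHf IHg.
- exact: eqX.
- by rewrite hM h'M IHf IHg.
Qed.

End FreeEvaluation.

(** * Differential forms over a truncated polynomial algebra *)

Section Forms.
Variables (k : fieldType) (q n : nat).

(* The pair (alpha, beta) stands for the product of the a_i^(alpha i) b_i^(beta i);
   the a_i satisfy a_i^(q + 1) = 0, and q + 1 will be the characteristic p. *)
Definition expo : Type := ({ffun 'I_n -> nat} * {ffun 'I_n -> nat})%type.
HB.instance Definition _ := GRing.Nmodule.on expo.

Definition mono : Type := ({ffun 'I_n -> 'I_q.+1} * {ffun 'I_n -> 'I_2})%type.
HB.instance Definition _ := Finite.on mono.

Definition expo_of (v : mono) : expo :=
  ([ffun i => v.1 i : nat], [ffun i => v.2 i : nat]).

Definition mono_of (m : expo) : mono :=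
  ([ffun i => inord (m.1 i)], [ffun i => inord (m.2 i)]).

Definition valid (m : expo) := [forall i, (m.1 i <= q)%N && (m.2 i <= 1)%N].

Lemma valid_expo_of v : valid (expo_of v).
Proof. by apply/forallP => i; rewrite !ffunE /= -ltnS ltn_ord -ltnS ltn_ord. Qed.

Lemma expo_ofK : cancel expo_of mono_of.
Proof.
by case=> al be; congr (_, _); apply/ffunP => i; rewrite !ffunE /= inord_val.
Qed.

Lemma mono_ofK m : valid m -> expo_of (mono_of m) = m.
Proof.
case: m => al be /forallP /= vm; congr (_, _); apply/ffunP => i; rewrite !ffunE /=.
  by rewrite inordK // ltnS; case/andP: (vm i).
by rewrite inordK // ltnS; case/andP: (vm i).
Qed.

Lemma validDl m m' : valid (m + m') -> valid m.
Proof.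
move=> /forallP vm; apply/forallP => i; case/andP: (vm i); rewrite !ffunE.
by move=> le1 le2; rewrite (leq_trans (leq_addr _ _) le1) (leq_trans (leq_addr _ _) le2).
Qed.

Lemma validDr m m' : valid (m + m') -> valid m'.
Proof. by rewrite addrC; apply: validDl. Qed.

Definition dform : Type := {ffun mono -> k^o}.
HB.instance Definition _ := GRing.Lmodule.copy dform {ffun mono -> k^o}.

(** Exponents in [expo] may overflow, so that monomials multiply by addition; overflowing ones give
    0 here, which builds in a_i^(q+1) = 0 and b_i^2 = 0. *)
Definition delta (m : expo) : dform := [ffun v => (expo_of v == m)%:R].

Lemma delta_invalid m : ~~ valid m -> delta m = 0.
Proof.
move=> vm; apply/ffunP => v; rewrite !ffunE; case: eqP => // defm.
by rewrite -defm valid_expo_of in vm.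
Qed.

Lemma delta_expo_of v w : delta (expo_of v) w = (v == w)%:R.
Proof. by rewrite ffunE (can_eq expo_ofK) eq_sym. Qed.

Lemma formE (x : dform) : x = \sum_v x v *: delta (expo_of v).
Proof.
apply/ffunP => w; rewrite sum_ffunE (bigD1 w) //= big1 ?addr0 => [|v nvw].
  by rewrite ffunE delta_expo_of eqxx [RHS]mulr1.
by rewrite ffunE delta_expo_of (negbTE nvw) [LHS]mulr0.
Qed.

Section LinearExtension.
Variables (W : lmodType k) (L : expo -> W).

Definition lext (x : dform) : W := \sum_v x v *: L (expo_of v).

Lemma lext_linear : linear lext.
Proof.
move=> c x y; rewrite /lext scaler_sumr -big_split /=; apply: eq_bigr => v _.
by rewrite !ffunE scalerDl scalerA.
Qed.

HB.instance Definition _ := GRing.isLinear.Build k dform W _ lext lext_linear.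

(** [lext] reads [L] only on the basis, so a rule for all exponents agrees with it exactly when it
    respects the monomial relations. *)
Lemma lext_delta m : (~~ valid m -> L m = 0) -> lext (delta m) = L m.
Proof.
case: (boolP (valid m)) => [vm _|nvm ->] //; last by rewrite delta_invalid // linear0.
rewrite /lext -{1}(mono_ofK vm) (bigD1 (mono_of m)) //= big1 ?addr0 => [|v nvm].
  by rewrite delta_expo_of eqxx scale1r mono_ofK.
by rewrite delta_expo_of eq_sym (negbTE nvm) scale0r.
Qed.

End LinearExtension.

Lemma form_linear_ind (P : dform -> Prop) :
    P 0 -> (forall c x y, P x -> P y -> P (c *: x + y)) ->
    (forall m, valid m -> P (delta m)) -> forall x, P x.
Proof.
move=> P0 PD Pd x; rewrite (formE x); elim/big_rec: _ => // v y _ Py.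
by apply: PD => //; apply: Pd; apply: valid_expo_of.
Qed.

(** Counts the transpositions that sort the concatenated [b]-parts. Unlike [inversions] it is
    additive in each argument without any disjointness, which gives associativity of the signs at
    once. *)
Definition inv2 (be be' : {ffun 'I_n -> nat}) : nat :=
  (\sum_(i < n) \sum_(j < n | j < i) be i * be' j)%N.

Lemma inv2Dl be1 be2 be : inv2 (be1 + be2) be = (inv2 be1 be + inv2 be2 be)%N.
Proof.
rewrite /inv2 -big_split /=; apply: eq_bigr => i _; rewrite -big_split /=.
by apply: eq_bigr => j _; rewrite ffunE mulnDl.
Qed.

Lemma inv2Dr be be1 be2 : inv2 be (be1 + be2) = (inv2 be be1 + inv2 be be2)%N.
Proof.
rewrite /inv2 -big_split /=; apply: eq_bigr => i _; rewrite -big_split /=.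
by apply: eq_bigr => j _; rewrite ffunE mulnDr.
Qed.

Lemma inv20l be : inv2 0 be = 0%N.
Proof. by rewrite /inv2 big1 // => i _; rewrite big1 // => j _; rewrite ffunE. Qed.

Lemma inv20r be : inv2 be 0 = 0%N.
Proof. by rewrite /inv2 big1 // => i _; rewrite big1 // => j _; rewrite ffunE muln0. Qed.

Definition form_mul (x y : dform) : dform :=
  lext (fun m => lext (fun m' => (-1) ^+ inv2 m.2 m'.2 *: delta (m + m')) y) x.

Lemma form_mul_linearl c x y z :
  form_mul (c *: x + y) z = c *: form_mul x z + form_mul y z.
Proof. exact: linearP. Qed.

Lemma form_mul_linearr c x y z :
  form_mul x (c *: y + z) = c *: form_mul x y + form_mul x z.
Proof.
rewrite /form_mul /lext -/(lext _ x) scaler_sumr -big_split /=; apply: eq_bigr => v _.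
have := lext_linear (fun m' => (-1) ^+ inv2 (expo_of v).2 m'.2 *: delta (expo_of v + m')).
by rewrite /lext => ->; rewrite scalerDr !scalerA mulrC.
Qed.

Lemma form_mul_delta m m' :
  form_mul (delta m) (delta m') = (-1) ^+ inv2 m.2 m'.2 *: delta (m + m').
Proof.
rewrite /form_mul lext_delta => [|nvm].
  rewrite lext_delta // => nvm'; rewrite delta_invalid ?scaler0 //.
  by apply: contra nvm'; apply: validDr.
rewrite /lext big1 // => v _; rewrite (@delta_invalid (m + _)) ?scaler0 //.
by apply: contra nvm; apply: validDl.
Qed.

Let form_mul0l y : form_mul 0 y = 0.
Proof. exact: linear0. Qed.

Let form_mul0r x : form_mul x 0 = 0.
Proof. by have := form_mul_linearr (- 1) x 0 0; rewrite !scaleN1r !addNr. Qed.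

Let form_mulDl x y z : form_mul (x + y) z = form_mul x z + form_mul y z.
Proof. by have := form_mul_linearl 1 x y z; rewrite !scale1r. Qed.

Let form_mulDr x y z : form_mul x (y + z) = form_mul x y + form_mul x z.
Proof. by have := form_mul_linearr 1 x y z; rewrite !scale1r. Qed.

Let form_mulZl c x y : form_mul (c *: x) y = c *: form_mul x y.
Proof. by have := form_mul_linearl c x 0 y; rewrite !addr0 form_mul0l addr0. Qed.

Let form_mulZr c x y : form_mul x (c *: y) = c *: form_mul x y.
Proof. by have := form_mul_linearr c x y 0; rewrite !addr0 form_mul0r addr0. Qed.

Lemma form_mulA : associative form_mul.
Proof.
move=> x y z; elim/form_linear_ind: x => [|c x1 x2 IH1 IH2|m _].
- by rewrite !form_mul0l.
- by rewrite !form_mul_linearl IH1 IH2.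
elim/form_linear_ind: y => [|c y1 y2 IH1 IH2|m' _].
- by rewrite form_mul0r !form_mul0l form_mul0r.
- by rewrite form_mul_linearl !form_mul_linearr form_mul_linearl IH1 IH2.
elim/form_linear_ind: z => [|c z1 z2 IH1 IH2|m'' _].
- by rewrite !form_mul0r.
- by rewrite !form_mul_linearr IH1 IH2.
rewrite !form_mul_delta form_mulZl form_mulZr !form_mul_delta !scalerA addrA.
rewrite inv2Dl inv2Dr -!exprD; congr ((-1) ^+ _ *: _).
by rewrite addnC -addnA.
Qed.

Lemma form_mul1l : left_id (delta 0) form_mul.
Proof.
elim/form_linear_ind => [|c x1 x2 IH1 IH2|m _]; first exact: form_mul0r.
  by rewrite form_mul_linearr IH1 IH2.
by rewrite form_mul_delta inv20l expr0 scale1r add0r.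
Qed.

Lemma form_mul1r : right_id (delta 0) form_mul.
Proof.
elim/form_linear_ind => [|c x1 x2 IH1 IH2|m _]; first exact: form_mul0l.
  by rewrite form_mul_linearl IH1 IH2.
by rewrite form_mul_delta inv20r expr0 scale1r addr0.
Qed.

Lemma valid0 : valid 0.
Proof. by apply/forallP => i; rewrite !ffunE. Qed.

Lemma delta0_neq0 : delta 0 != 0.
Proof.
apply/eqP => /ffunP /(_ (mono_of 0)); rewrite -{1}(mono_ofK valid0) delta_expo_of.
by rewrite eqxx ffunE => /eqP; rewrite oner_eq0.
Qed.

HB.instance Definition _ := GRing.Zmodule_isNzRing.Build dform
  form_mulA form_mul1l form_mul1r form_mulDl form_mulDr delta0_neq0.

HB.instance Definition _ := GRing.Lmodule_isLalgebra.Build k dform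
  (fun c x y => esym (form_mulZl c x y)).

HB.instance Definition _ := GRing.Lalgebra_isAlgebra.Build k dform
  (fun c x y => esym (form_mulZr c x y)).

Lemma deltaM m m' : delta m * delta m' = (-1) ^+ inv2 m.2 m'.2 *: delta (m + m').
Proof. exact: form_mul_delta. Qed.

Lemma delta0 : delta 0 = 1.
Proof. by []. Qed.

End Forms.

(** * Signs when sorting products of anticommuting elements *)

Lemma anticomm_exp (T : pzRingType) (x y : T) r s : x * y = - (y * x) ->
  x ^+ r * y ^+ s = (-1) ^+ (r * s) * (y ^+ s * x ^+ r).
Proof.
move=> xy; have x1 t : x * y ^+ t = (-1) ^+ t * (y ^+ t * x).
  elim: t => [|t IHt]; first by rewrite !expr0 !mul1r mulr1.
  rewrite exprSr mulrA IHt -!mulrA xy !mulrN [in RHS]exprS mulN1r mulNr.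
  by rewrite !mulrA.
elim: r => [|r IHr]; first by rewrite !expr0 !mul1r mulr1.
rewrite exprS -mulrA IHr [LHS]mulrA commr_sign -mulrA [x * (_ * _)]mulrA x1.
by rewrite !mulrA -exprD mulSn addnC.
Qed.

Section SortedProducts.
Variables (T : pzRingType) (n : nat) (X Y : 'I_n -> T) (e : 'I_n -> 'I_n -> nat).
Hypothesis XY : forall i j : 'I_n, (j < i)%N -> X i * Y j = (-1) ^+ e i j * (Y j * X i).

Let lt_ord := relpre (@nat_of_ord n) ltn.

(** To get next to [X j], the factor [Y j] has to pass exactly the [X i] with j < i; these pairs
    make up the exponent. *)
Lemma prod_sorted_mul (s : seq 'I_n) : sorted lt_ord s ->
  (\prod_(i <- s) X i) * (\prod_(i <- s) Y i)
    = (-1) ^+ (\sum_(i <- s) \sum_(j <- s | (j < i)%N) e i j) * \prod_(i <- s) (X i * Y i).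
Proof.
have lt_tr : transitive lt_ord by move=> b a c; apply: ltn_trans.
elim: s => [|i s IHs] ss; first by rewrite !big_nil expr0 !mul1r.
have gt_i j : j \in s -> (i < j)%N by move: ss => /= /(order_path_min lt_tr)/allP/(_ j).
have mvY (r : seq 'I_n) : {subset r <= s} ->
    (\prod_(l <- r) X l) * Y i = (-1) ^+ (\sum_(l <- r) e l i) * (Y i * \prod_(l <- r) X l).
  elim: r => [|l r IHr] rs; first by rewrite !big_nil expr0 !mul1r mulr1.
  rewrite !big_cons -mulrA IHr => [|a ar]; last by apply: rs; rewrite inE ar orbT.
  rewrite [LHS]mulrA commr_sign -mulrA [X l * (_ * _)]mulrA XY; last by apply/gt_i/rs/mem_head.
  by rewrite !mulrA -exprD addnC.
rewrite !big_cons mulrA -(mulrA (X i)) mvY // -!mulrA IHs ?(path_sorted ss) //.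
rewrite ltnn.
have -> : \sum_(j <- s | (j < i)%N) e i j = 0%N.
  by rewrite big_seq_cond big1 // => j /andP[/gt_i lt_ij]; rewrite ltnNge ltnW.
have -> : (\sum_(l <- s) \sum_(j <- i :: s | (j < l)%N) e l j
           = \sum_(l <- s) e l i + \sum_(l <- s) \sum_(j <- s | (j < l)%N) e l j)%N.
  rewrite big_seq [in RHS]big_seq [X in (_ + X)%N]big_seq -big_split /=; apply: eq_bigr => l /gt_i lt_il.
  by rewrite big_cons lt_il.
rewrite add0n exprD; set c := \sum_(l <- s) e l i; set d := (\sum_(i <- s) _)%N.
rewrite [LHS]mulrA commr_sign -!mulrA; congr (_ * _).
by rewrite [Y i * (_ * _)]mulrA commr_sign -mulrA [LHS]mulrA commr_sign -mulrA.
Qed.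

End SortedProducts.

Lemma sorted_enum_ord n : sorted (relpre (@nat_of_ord n) ltn) (index_enum 'I_n).
Proof.
by rewrite -sorted_map [index_enum _]unlock -enumT val_enum_ord iota_ltn_sorted.
Qed.

(** * Generators of the algebra of forms and its universal property *)

Section FormGenerators.
Variables (k : fieldType) (q n : nat).
Local Notation dform := (dform k q n).
Local Notation expo := (expo n).
Local Notation delta := (@delta k q n).
Implicit Types (i j : 'I_n) (m : expo) (x y z : dform).

Definition ea i : expo := ([ffun j => (j == i) : nat], 0).
Definition eb i : expo := (0, [ffun j => (j == i) : nat]).
Definition fa i : dform := delta (ea i).
Definition fb i : dform := delta (eb i).

Lemma fa_delta i m : fa i * delta m = delta (ea i + m).
Proof. by rewrite /fa deltaM inv20l scale1r. Qed.

Lemma delta_fa i m : delta m * fa i = delta (ea i + m).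
Proof. by rewrite /fa deltaM inv20r scale1r addrC. Qed.

Lemma fb_delta i m : fb i * delta m = (-1) ^+ inv2 (eb i).2 m.2 *: delta (eb i + m).
Proof. exact: deltaM. Qed.

Lemma fa_central i x : fa i * x = x * fa i.
Proof.
elim/form_linear_ind: x => [|c x y IHx IHy|m _]; first by rewrite mulr0 mul0r.
  by rewrite mulrDr mulrDl -scalerAl -scalerAr IHx IHy.
by rewrite fa_delta delta_fa.
Qed.

Lemma inv2_eb i j : inv2 (eb i).2 (eb j).2 = (j < i)%N.
Proof.
rewrite /inv2 (bigD1 i) //= [X in (_ + X)%N]big1 ?addn0 => [|l nli].
  rewrite (bigID (pred1 j)) /= [X in (_ + X)%N]big1 ?addn0 => [|l /andP[_ nlj]].
    case: (ltnP j i) => lt_ji.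
      by rewrite (big_pred1 j) => [|l /=]; rewrite ?ffunE ?eqxx //; case: eqP => [->|]; rewrite ?lt_ji ?andbF.
    by rewrite big_pred0 // => l; case: eqP => [->|]; rewrite ?andbF // ltnNge lt_ji.
  by rewrite !ffunE (negbTE nlj) muln0.
by rewrite big1 // => l' _; rewrite !ffunE (negbTE nli).
Qed.

Lemma fb_anticomm i j : fb i * fb j = - (fb j * fb i).
Proof.
rewrite !fb_delta !inv2_eb addrC; case: (ltngtP i j) => [||/val_inj ->].
- by rewrite expr0 expr1 scaleN1r scale1r opprK.
- by rewrite expr0 expr1 scaleN1r scale1r.
by rewrite delta_invalid ?scaler0 ?oppr0 //; apply/forallPn; exists j; rewrite !ffunE eqxx.
Qed.

Lemma fb_sqr i : fb i * fb i = 0.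
Proof.
rewrite fb_delta delta_invalid ?scaler0 //.
by apply/forallPn; exists i; rewrite !ffunE eqxx andbF.
Qed.

Lemma fa_exp i r : fa i ^+ r = delta (ea i *+ r).
Proof. by elim: r => [|r IHr]; rewrite ?expr0 ?mulr0n // exprS IHr fa_delta mulrS. Qed.

Lemma ea_muln i r j : (ea i *+ r).1 j = (r * (j == i))%N.
Proof. by elim: r => [|r IHr]; rewrite ?mulr0n ?mulrS !ffunE // -/((ea i *+ r).1 j) IHr mulSn. Qed.

Lemma fa_nilp i : fa i ^+ q.+1 = 0.
Proof.
rewrite fa_exp delta_invalid //; apply/forallPn; exists i.
by rewrite ea_muln eqxx muln1 ltnn.
Qed.

Lemma expo_subK m m' : (forall i, (m'.1 i <= m.1 i)%N && (m'.2 i <= m.2 i)%N) ->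
  {m0 | m = m' + m0}.
Proof.
move=> le; exists ([ffun i => m.1 i - m'.1 i]%N, [ffun i => m.2 i - m'.2 i]%N).
case: m m' le => a b [a' b'] /= le; congr (_, _); apply/ffunP => i; rewrite !ffunE;
  by case/andP: (le i) => ? ?; rewrite [RHS]subnKC.
Qed.

Definition edeg m := (\sum_i (m.1 i + m.2 i))%N.

Lemma edegD m m' : edeg (m + m') = (edeg m + edeg m')%N.
Proof.
by rewrite /edeg -big_split /=; apply: eq_bigr => i _; rewrite !ffunE addnACA.
Qed.

Lemma edeg_ea i : edeg (ea i) = 1%N.
Proof.
rewrite /edeg (bigD1 i) //= big1 => [|j nji]; first by rewrite !ffunE eqxx.
by rewrite !ffunE (negbTE nji).
Qed.

Lemma edeg_eb i : edeg (eb i) = 1%N.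
Proof.
rewrite /edeg (bigD1 i) //= big1 => [|j nji]; first by rewrite !ffunE eqxx.
by rewrite !ffunE (negbTE nji).
Qed.

(** Induction on the total degree, splitting off one generator. It reduces identities such as the
    Leibniz rule to the effect of a single [fa i] or [fb i]. *)
Lemma form_ind (P : dform -> Prop) :
    P 0 -> (forall c x y, P x -> P y -> P (c *: x + y)) -> P 1 ->
    (forall i x, P x -> P (fa i * x)) -> (forall i x, P x -> P (fb i * x)) ->
  forall x, P x.
Proof.
move=> P0 PD P1 Pa Pb; elim/form_linear_ind => // m _.
have [d] := ubnP (edeg m); elim: d m => // d IHd m le_md.
have [m0|] := boolP [forall i, (m.1 i == 0%N) && (m.2 i == 0%N)].
  suff -> : m = 0 by [].
  case: m m0 {le_md} => a b /= /forallP m0; congr (_, _); apply/ffunP => i;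
    by case/andP: (m0 i) => /eqP a0 /eqP b0; rewrite ffunE.
case/forallPn => i; rewrite negb_and => /orP[nz|nz].
  have [j|m' def_m] := @expo_subK m (ea i).
    by rewrite !ffunE; case: eqP => // ->; rewrite lt0n nz.
  move: le_md; rewrite def_m edegD edeg_ea -fa_delta => /= le_md.
  by apply/Pa/IHd.
have [j|m' def_m] := @expo_subK m (eb i).
  by rewrite !ffunE; case: eqP => // ->; rewrite lt0n nz.
move: le_md; rewrite def_m edegD edeg_eb => /= le_md.
(* The sign is its own inverse, and the summand 0 gives the shape required by [PD]. *)
have -> : delta (eb i + m') = (-1) ^+ inv2 (eb i).2 m'.2 *: (fb i * delta m') + 0.
  by rewrite fb_delta scalerA -exprD addnn -mul2n exprM sqrrN !expr1n scale1r addr0.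
by apply: PD => //; apply/Pb/IHd.
Qed.

Section Substitution.
Variables (T : algType k) (u v : 'I_n -> T).
Hypothesis uu : forall i j, u i * u j = u j * u i.
Hypothesis uv : forall i j, u i * v j = v j * u i.
Hypothesis u_nilp : forall i, u i ^+ q.+1 = 0.
Hypothesis vv : forall i j, v i * v j = - (v j * v i).
Hypothesis v_sqr : forall i, v i * v i = 0.

Definition eval_expo m : T := \prod_i (u i ^+ m.1 i * v i ^+ m.2 i).

Lemma eval_expoM m m' :
  eval_expo m * eval_expo m' = (-1) ^+ inv2 m.2 m'.2 * eval_expo (m + m').
Proof.
have cuu i j r s : u i ^+ r * u j ^+ s = u j ^+ s * u i ^+ r by apply/commrX/commr_sym/commrX/uu.
have cuv i j r s : u i ^+ r * v j ^+ s = v j ^+ s * u i ^+ r.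
  by apply/commrX/commr_sym/commrX/commr_sym/uv.
rewrite /eval_expo (prod_sorted_mul (e := fun i j => (m.2 i * m'.2 j)%N)) ?sorted_enum_ord //.
  congr (_ * _); apply: eq_bigr => i _; rewrite !ffunE !exprD.
  by rewrite -!mulrA; congr (_ * _); rewrite !mulrA cuv.
move=> i j _.
transitivity (u i ^+ m.1 i * u j ^+ m'.1 j * (v i ^+ m.2 i * v j ^+ m'.2 j)).
  by rewrite -!mulrA; congr (_ * _); rewrite !mulrA -cuv.
rewrite (anticomm_exp _ _ (vv i j)) cuu [LHS]mulrA commr_sign -!mulrA.
by congr (_ * (_ * _)); rewrite !mulrA cuv.
Qed.

Lemma eval_expo_invalid m : ~~ valid q m -> eval_expo m = 0.
Proof.
case/forallPn => i; rewrite negb_and -!ltnNge => iP.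
have : u i ^+ m.1 i * v i ^+ m.2 i = 0.
  case/orP: iP => [lt_q|lt1].
    by rewrite -(subnK lt_q) exprD u_nilp mulr0 mul0r.
  by rewrite -(subnK lt1) exprD expr2 v_sqr !mulr0.
rewrite /eval_expo; elim: (index_enum _) (mem_index_enum i) => // j s IHs.
rewrite inE big_cons; case/predU1P => [<- ->|/IHs IH /IH ->]; first by rewrite mul0r.
by rewrite mulr0.
Qed.

(** The [u i] satisfy the relations of the a_i and the [v i] those of the b_i. Three targets occur:
    the forms themselves, forms in other variables, and the unitization of G_0. *)
Definition form_subst : dform -> T := lext eval_expo.
HB.instance Definition _ := GRing.Linear.on form_subst.

Lemma form_subst_delta m : form_subst (delta m) = eval_expo m.
Proof. exact/lext_delta/eval_expo_invalid. Qed.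

Lemma form_subst_monoid : monoid_morphism form_subst.
Proof.
split=> [|x y].
  rewrite -delta0 form_subst_delta /eval_expo big1 // => i _.
  by rewrite !ffunE !expr0 mulr1.
elim/form_linear_ind: x => [|c x1 x2 IH1 IH2|m _].
- by rewrite mul0r linear0 mul0r.
- by rewrite mulrDl -scalerAl !linearP /= IH1 IH2 mulrDl scalerAl.
elim/form_linear_ind: y => [|c y1 y2 IH1 IH2|m' _].
- by rewrite mulr0 linear0 mulr0.
- by rewrite mulrDr -scalerAr !linearP /= IH1 IH2 mulrDr scalerAr.
rewrite deltaM linearZ /= !form_subst_delta eval_expoM.
by rewrite -[in RHS]signr_odd mulr_sign -[in LHS]signr_odd scaler_sign.
Qed.

Lemma form_subst_fa i : form_subst (fa i) = u i.
Proof.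
rewrite form_subst_delta /eval_expo.
rewrite (eq_bigr (fun j => if j == i then u i else 1)) => [|j _].
  by rewrite -big_mkcond big_pred1_eq.
by rewrite !ffunE expr0 mulr1; case: eqP => [->|]; rewrite ?expr0 ?expr1.
Qed.

Lemma form_subst_fb i : form_subst (fb i) = v i.
Proof.
rewrite form_subst_delta /eval_expo.
rewrite (eq_bigr (fun j => if j == i then v i else 1)) => [|j _].
  by rewrite -big_mkcond big_pred1_eq.
by rewrite !ffunE expr0 mul1r; case: eqP => [->|]; rewrite ?expr0 ?expr1.
Qed.

End Substitution.

(** Substituting the generators for themselves is the identity, and its value on a monomial is the
    right-hand side. *)
Lemma delta_prod m : delta m = \prod_i (fa i ^+ m.1 i * fb i ^+ m.2 i).
Proof.
have fafa i j : fa i * fa j = fa j * fa i by apply: fa_central.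
have fafb i j : fa i * fb j = fb j * fa i by apply: fa_central.
pose h := form_subst fa fb.
suff hK x : h x = x.
  by rewrite -{1}[delta m]hK /h (form_subst_delta fa_nilp fb_sqr).
elim/form_ind: x => [|c x y IHx IHy||i x IHx|i x IHx].
- exact: linear0.
- by rewrite /h linearP /= -/h IHx IHy.
- exact: (form_subst_monoid fafa fafb fa_nilp fb_anticomm fb_sqr).1.
- rewrite /h (form_subst_monoid fafa fafb fa_nilp fb_anticomm fb_sqr).2.
  by rewrite (form_subst_fa fa_nilp fb_sqr) -/h IHx.
rewrite /h (form_subst_monoid fafa fafb fa_nilp fb_anticomm fb_sqr).2.
by rewrite (form_subst_fb fa_nilp fb_sqr) -/h IHx.
Qed.

End FormGenerators.

(** * The exterior derivative and the Euler homotopy *)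

Section ExponentOperations.
Variable n : nat.
Implicit Types (i : 'I_n) (m : expo n).

Definition bdeg m := (\sum_i m.2 i)%N.
Definition sub_ea i m : expo n := ([ffun j => m.1 j - (j == i)]%N, m.2).
Definition sub_eb i m : expo n := (m.1, [ffun j => m.2 j - (j == i)]%N).

End ExponentOperations.

HB.lock Definition grade (k : fieldType) (q n : nat) : dform k q n -> dform k q n :=
  lext (fun m => (-1) ^+ bdeg m *: delta k q m).

HB.lock Definition pda (k : fieldType) (q n : nat) (i : 'I_n) : dform k q n -> dform k q n :=
  lext (fun m => (m.1 i)%:R *: delta k q (sub_ea i m)).

(** With [odd (m.2 i)] as coefficient the exponent 2 is sent to 0, as b_i^2 = 0 demands, although
    [sub_eb] lowers it to the admissible exponent 1. *)
HB.lock Definition pdb (k : fieldType) (q n : nat) (i : 'I_n) : dform k q n -> dform k q n :=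
  lext (fun m =>
    ((odd (m.2 i))%:R * (-1) ^+ inv2 (eb i).2 m.2) *: delta k q (sub_eb i m)).

HB.lock Definition dd (k : fieldType) (q n : nat) (x : dform k q n) : dform k q n :=
  \sum_i fb k q i * pda i x.

Section ExteriorDerivative.
Variables (k : fieldType) (q n : nat).
Hypothesis char_k : q.+1 \in [pchar k].
Local Notation dform := (dform k q n).
Local Notation expo := (expo n).
Local Notation delta := (@delta k q n).
Local Notation fa := (@fa k q n).
Local Notation fb := (@fb k q n).
Local Notation ea := (@ea n).
Local Notation eb := (@eb n).
Implicit Types (i j : 'I_n) (m : expo) (x y z : dform).

Lemma bdegD m m' : bdeg (m + m') = (bdeg m + bdeg m')%N.
Proof. by rewrite /bdeg -big_split /=; apply: eq_bigr => i _; rewrite !ffunE. Qed.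

Lemma bdeg_ea i : bdeg (ea i) = 0%N.
Proof. by rewrite /bdeg big1 // => j _; rewrite !ffunE. Qed.

Lemma bdeg_eb i : bdeg (eb i) = 1%N.
Proof.
rewrite /bdeg (bigD1 i) //= big1 => [|j nji]; first by rewrite !ffunE eqxx.
by rewrite !ffunE (negbTE nji).
Qed.

Local Notation grade := (@grade k q n).
Local Notation pda := (@pda k q n).
Local Notation pdb := (@pdb k q n).
Local Notation dd := (@dd k q n).
Local Notation sub_ea := (@sub_ea n).
Local Notation sub_eb := (@sub_eb n).

Lemma grade_linear : linear grade.
Proof. by rewrite unlock; apply: lext_linear. Qed.

HB.instance Definition _ := GRing.isLinear.Build k dform dform _ grade grade_linear.

Lemma grade_delta m : grade (delta m) = (-1) ^+ bdeg m *: delta m.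
Proof. by rewrite unlock; apply: lext_delta => /delta_invalid ->; rewrite scaler0. Qed.

Lemma grade1 : grade 1 = 1.
Proof.
by rewrite -delta0 grade_delta /bdeg big1 ?expr0 ?scale1r // => i _; rewrite ffunE.
Qed.

Lemma grade_fa i x : grade (fa i * x) = fa i * grade x.
Proof.
elim/form_linear_ind: x => [|c x y IHx IHy|m _]; first by rewrite !(mulr0, linear0).
  by rewrite mulrDr -scalerAr !linearP /= IHx IHy mulrDr scalerAr.
by rewrite fa_delta !grade_delta bdegD bdeg_ea -scalerAr fa_delta.
Qed.

Lemma grade_fb i x : grade (fb i * x) = - (fb i * grade x).
Proof.
elim/form_linear_ind: x => [|c x y IHx IHy|m _]; first by rewrite !(mulr0, linear0).
  by rewrite mulrDr -scalerAr !linearP /= IHx IHy mulrDr opprD -scalerAr scalerN.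
rewrite fb_delta linearZ /= !grade_delta bdegD bdeg_eb -scalerAr fb_delta.
by rewrite exprS mulN1r scaleNr scalerN !scalerA mulrC.
Qed.

Lemma gradeM x y : grade (x * y) = grade x * grade y.
Proof.
elim/form_ind: x => [|c x x' IH IH'||i x IHx|i x IHx].
- by rewrite mul0r linear0 mul0r.
- by rewrite mulrDl -scalerAl !linearP /= IH IH' mulrDl scalerAl.
- by rewrite grade1 !mul1r.
- by rewrite -mulrA !grade_fa IHx mulrA.
- by rewrite -mulrA !grade_fb IHx mulNr mulrA.
Qed.

Lemma grade_fa1 i : grade (fa i) = fa i.
Proof. by rewrite -[fa i]mulr1 grade_fa grade1. Qed.

Lemma fb_grade i x : x * fb i = fb i * grade x.
Proof.
elim/form_ind: x => [|c x x' IH IH'||j x IHx|j x IHx].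
- by rewrite linear0 mulr0 mul0r.
- by rewrite mulrDl linearP /= mulrDr -scalerAl -scalerAr IH IH'.
- by rewrite grade1 mul1r mulr1.
- by rewrite grade_fa -mulrA IHx mulrA fa_central -mulrA.
- by rewrite grade_fb -mulrA IHx mulrA fb_anticomm mulrN mulNr mulrA.
Qed.

Lemma even_central x y : grade x = x -> x * y = y * x.
Proof.
move=> ev; elim/form_ind: y => [|c y y' IH IH'||j y IHy|j y IHy].
- by rewrite mulr0 mul0r.
- by rewrite mulrDl mulrDr -scalerAl -scalerAr IH IH'.
- by rewrite mulr1 mul1r.
- by rewrite mulrA -fa_central -!mulrA IHy.
- by rewrite mulrA fb_grade ev -!mulrA IHy.
Qed.

Lemma odd_grade x y : grade x = - x -> x * y = grade y * x.
Proof.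
move=> od; elim/form_ind: y => [|c y y' IH IH'||j y IHy|j y IHy].
- by rewrite linear0 mulr0 mul0r.
- by rewrite linearP /= mulrDl mulrDr -scalerAl -scalerAr IH IH'.
- by rewrite grade1 mulr1 mul1r.
- by rewrite grade_fa mulrA -fa_central -!mulrA IHy.
- by rewrite mulrA fb_grade od grade_fb mulrN !mulNr -!mulrA IHy.
Qed.


Lemma ea_sub i m : (0 < m.1 i)%N -> ea i + sub_ea i m = m.
Proof.
case: m => a b /= a0; congr (_, _); apply/ffunP => j; rewrite !ffunE //.
by apply: subnKC; case: eqP => [->|].
Qed.

Lemma eb_sub i m : (0 < m.2 i)%N -> eb i + sub_eb i m = m.
Proof.
case: m => a b /= a0; congr (_, _); apply/ffunP => j; rewrite !ffunE //.
by apply: subnKC; case: eqP => [->|].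
Qed.

Lemma sub_eaK i m : sub_ea i (ea i + m) = m.
Proof.
by case: m => a b; congr (_, _); apply/ffunP => j; rewrite !ffunE // addKn.
Qed.

Lemma sub_ebK i m : sub_eb i (eb i + m) = m.
Proof.
by case: m => a b; congr (_, _); apply/ffunP => j; rewrite !ffunE // addKn.
Qed.

Lemma sub_eaD i j m : i != j -> sub_ea i (ea j + m) = ea j + sub_ea i m.
Proof.
case: m => a b nij; congr (_, _); apply/ffunP => l; rewrite !ffunE //=.
by case: (l =P i) => [->|_]; rewrite ?(negbTE nij) ?subn0.
Qed.

Lemma sub_ebD i j m : i != j -> sub_eb i (eb j + m) = eb j + sub_eb i m.
Proof.
case: m => a b nij; congr (_, _); apply/ffunP => l; rewrite !ffunE //=.
by case: (l =P i) => [->|_]; rewrite ?(negbTE nij) ?subn0.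
Qed.

Lemma sub_ea_eb i j m : sub_ea i (eb j + m) = eb j + sub_ea i m.
Proof. by case: m => a b; congr (_, _); apply/ffunP => l; rewrite !ffunE. Qed.

Lemma sub_eb_ea i j m : sub_eb i (ea j + m) = ea j + sub_eb i m.
Proof. by case: m => a b; congr (_, _); apply/ffunP => l; rewrite !ffunE. Qed.

Lemma pda_linear i : linear (pda i).
Proof. by rewrite unlock; apply: lext_linear. Qed.

HB.instance Definition _ i := GRing.isLinear.Build k dform dform _ (pda i) (pda_linear i).

(** The critical overflow is a_i^(q+1): its derivative (q+1) a_i^q vanishes because q + 1 is the
    characteristic. *)
Lemma pda_delta i m : pda i (delta m) = (m.1 i)%:R *: delta (sub_ea i m).
Proof.
rewrite unlock; apply: lext_delta => /forallPn[j]; rewrite negb_and -!ltnNge => iP.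
have [->|nz] := eqVneq ((m.1 i)%:R : k) 0; first by rewrite scale0r.
rewrite delta_invalid ?scaler0 //; apply/forallPn; exists j.
rewrite negb_and -!ltnNge ffunE; case/orP: iP => [lt_qm|->]; last by rewrite orbT.
apply/orP; left; case: eqP => [ji|_]; last by rewrite subn0.
rewrite ltn_subRL add1n ltn_neqAle lt_qm andbT.
by apply: contraNneq nz => eqm; rewrite -ji -eqm; apply/eqP/pcharf0.
Qed.

Lemma pda1 i : pda i 1 = 0.
Proof. by rewrite -delta0 pda_delta ffunE scale0r. Qed.

Lemma pda_fa i j x : pda i (fa j * x) = (i == j)%:R *: x + fa j * pda i x.
Proof.
elim/form_linear_ind: x => [|c x y IHx IHy|m _].
- by rewrite !(mulr0, linear0, addr0).
- rewrite mulrDr -scalerAr !linearP /= IHx IHy mulrDr -scalerAr.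
  by rewrite !scalerDr !scalerA (mulrC c) addrACA.
rewrite fa_delta !pda_delta -scalerAr fa_delta !ffunE.
have [->|nij] := eqVneq i j; last by rewrite sub_eaD // scale0r !add0r.
rewrite sub_eaK natrD scalerDl; congr (_ + _).
have [->|m0] := posnP (m.1 j); first by rewrite !scale0r.
by rewrite ea_sub.
Qed.

Lemma pda_fb i j x : pda i (fb j * x) = fb j * pda i x.
Proof.
elim/form_linear_ind: x => [|c x y IHx IHy|m _].
- by rewrite !(mulr0, linear0, scaler0).
- by rewrite mulrDr -scalerAr !linearP /= IHx IHy mulrDr -scalerAr.
rewrite fb_delta !linearZ /= !pda_delta sub_ea_eb !ffunE add0r.
by rewrite -scalerAr fb_delta !scalerA mulrC.
Qed.

Lemma pdb_linear i : linear (pdb i).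
Proof. by rewrite unlock; apply: lext_linear. Qed.

HB.instance Definition _ i := GRing.isLinear.Build k dform dform _ (pdb i) (pdb_linear i).

Lemma pdb_delta i m :
  pdb i (delta m) = ((odd (m.2 i))%:R * (-1) ^+ inv2 (eb i).2 m.2) *: delta (sub_eb i m).
Proof.
rewrite unlock; apply: lext_delta => /forallPn[j]; rewrite negb_and -!ltnNge => iP.
have [odm|] := boolP (odd (m.2 i)); last by rewrite mul0r scale0r.
rewrite delta_invalid ?scaler0 //; apply/forallPn; exists j.
rewrite negb_and -!ltnNge ffunE; case/orP: iP => [->|lt1] //.
apply/orP; right; case: eqP => [ji|_]; last by rewrite subn0.
by move: odm lt1; rewrite -ji subn1; case: (m.2 j) => [|[|[|]]].
Qed.

Lemma pdb1 i : pdb i 1 = 0.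
Proof. by rewrite -delta0 pdb_delta ffunE mul0r scale0r. Qed.

Lemma pdb_fa i j x : pdb i (fa j * x) = fa j * pdb i x.
Proof.
elim/form_linear_ind: x => [|c x y IHx IHy|m _].
- by rewrite !(mulr0, linear0).
- by rewrite mulrDr -scalerAr !linearP /= IHx IHy mulrDr -scalerAr.
by rewrite fa_delta !pdb_delta sub_eb_ea !ffunE !add0r /= add0r -scalerAr fa_delta.
Qed.

Lemma pdb_fb i j x : pdb i (fb j * x) = (i == j)%:R *: x - fb j * pdb i x.
Proof.
elim/form_linear_ind: x => [|c x y IHx IHy|m _].
- by rewrite !(mulr0, linear0, subr0).
- rewrite mulrDr -scalerAr !linearP /= IHx IHy mulrDr -scalerAr.
  by rewrite opprD !scalerDr scalerN !scalerA (mulrC c) addrACA.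
rewrite fb_delta linearZ /= !pdb_delta -scalerAr fb_delta !scalerA.
have inv_sub : odd (m.2 i) -> inv2 (eb j).2 m.2 = ((i < j) + inv2 (eb j).2 (sub_eb i m).2)%N.
  by move=> od; rewrite -[in LHS](@eb_sub i m) ?odd_gt0 // inv2Dr inv2_eb.
rewrite -[(eb j + m).2]/((eb j).2 + m.2) inv2Dr inv2_eb.
have -> : ((eb j).2 + m.2) i = ((i == j) + m.2 i)%N by rewrite !ffunE.
have [eq_ij|nij] := eqVneq i j.
  rewrite -{}eq_ij in inv_sub *; rewrite sub_ebK ltnn add0n add1n /= scale1r mulrCA.
  rewrite -expr2 sqrr_sign mulr1; case: (boolP (odd _)) inv_sub => [od|_] inv_sub /=.
    by rewrite eb_sub ?odd_gt0 // inv_sub // ltnn mul1r -expr2 sqrr_sign scale1r scale0r subrr.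
  by rewrite scale1r !mul0r scale0r subr0.
rewrite add0n scale0r add0r sub_ebD //; case: (boolP (odd _)) inv_sub => [od|_] inv_sub.
  rewrite inv_sub // !mul1r -scaleNr -!exprD -[in RHS]mulN1r -exprS.
  by congr ((-1) ^+ _ *: _); case: (ltngtP i j) nij => [||/val_inj ->]; rewrite ?eqxx //=; lia.
by rewrite !mul0r mulr0 !scale0r oppr0.
Qed.

Lemma ddE x : dd x = \sum_i fb i * pda i x.
Proof. by rewrite unlock. Qed.

Lemma dd_linear : linear dd.
Proof.
move=> c x y; rewrite !ddE scaler_sumr -big_split /=; apply: eq_bigr => i _.
by rewrite linearP mulrDr -scalerAr.
Qed.

HB.instance Definition _ := GRing.isLinear.Build k dform dform _ dd dd_linear.

Lemma dd1 : dd 1 = 0.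
Proof. by rewrite !ddE big1 // => i _; rewrite pda1 mulr0. Qed.

Lemma dd_fa j x : dd (fa j * x) = fb j * x + fa j * dd x.
Proof.
rewrite !ddE mulr_sumr (bigD1 j) //= [in RHS](bigD1 j) //= addrA; congr (_ + _).
  by rewrite pda_fa eqxx scale1r mulrDr !mulrA (fa_central j (fb j)).
apply: eq_bigr => i nij; rewrite pda_fa (negbTE nij) scale0r add0r.
by rewrite !mulrA (fa_central j (fb i)).
Qed.

Lemma dd_fb j x : dd (fb j * x) = - (fb j * dd x).
Proof.
rewrite !ddE mulr_sumr -sumrN; apply: eq_bigr => i _.
by rewrite pda_fb !mulrA fb_anticomm mulNr.
Qed.

Lemma ddd x : dd (dd x) = 0.
Proof.
elim/form_ind: x => [|c x y IHx IHy||i x IHx|i x IHx].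
- by rewrite !linear0.
- by rewrite !linearP /= IHx IHy scaler0 addr0.
- by rewrite dd1 linear0.
- by rewrite dd_fa linearD /= dd_fb dd_fa IHx mulr0 addr0 addNr.
- by rewrite dd_fb linearN /= dd_fb IHx mulr0 !oppr0.
Qed.

Lemma ddM x y : dd (x * y) = dd x * y + grade x * dd y.
Proof.
elim/form_ind: x => [|c x x' IH IH'||i x IHx|i x IHx].
- by rewrite mul0r !linear0 !mul0r addr0.
- rewrite mulrDl -scalerAl !linearP /= IH IH' !mulrDl scalerDr !scalerAl.
  by rewrite addrACA.
- by rewrite dd1 grade1 !mul1r mul0r add0r.
- by rewrite -mulrA !dd_fa grade_fa IHx mulrDl mulrDr !mulrA addrA.
- by rewrite -mulrA !dd_fb grade_fb IHx !mulNr mulrDr opprD !mulrA.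
Qed.

Lemma grade_dd x : grade (dd x) = - dd (grade x).
Proof.
elim/form_ind: x => [|c x y IHx IHy||i x IHx|i x IHx].
- by rewrite !linear0.
- by rewrite !linearP /= IHx IHy.
- by rewrite dd1 grade1 dd1 linear0 oppr0.
- by rewrite dd_fa grade_fa dd_fa linearD /= grade_fa grade_fb IHx mulrN opprD.
- by rewrite dd_fb grade_fb !linearN /= dd_fb grade_fb IHx mulrN.
Qed.

Lemma dd_fa1 i : dd (fa i) = fb i.
Proof. by rewrite -[fa i]mulr1 dd_fa dd1 mulr0 addr0 mulr1. Qed.

Definition top_mono : mono q n := ([ffun=> ord_max], [ffun=> ord_max]).

(** A contribution through b_i would have to come from a monomial with exponent q + 1 at a_i. Thus
    the top coefficient depends only on the class modulo exact forms. *)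
Lemma dd_top x : dd x top_mono = 0.
Proof.
elim/form_linear_ind: x => [|c x y IHx IHy|m vm].
- by rewrite linear0 ffunE.
- by rewrite linearP /= !ffunE IHx IHy scaler0 addr0.
rewrite !ddE sum_ffunE big1 // => i _; rewrite pda_delta -scalerAr fb_delta !ffunE.
case: eqP => [/(congr1 (fun e : expo => e.1 i))|_]; last by rewrite !scaler0.
rewrite !ffunE /= eqxx subn1 add0r => eq_q.
move: vm => /forallP/(_ i)/andP[le_q _]; move: eq_q le_q.
case: (m.1 i) => [|r] /=; first by rewrite scale0r.
by move=> ->; rewrite ltnn.
Qed.

(** Interior multiplication by the Euler field of the i-th pair of variables; [euler i] is the Lie
    derivative along it. Each pair has its own field, since modulo p a total weight can vanish
    without the separate ones doing so. *)
Definition contract i x := fa i * pdb i x.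
Definition euler i x := fa i * pda i x + fb i * pdb i x.

Lemma euler_linear i : linear (euler i).
Proof.
move=> c x y; rewrite /euler !linearP /= !mulrDr -!scalerAr scalerDr.
by rewrite addrACA.
Qed.

HB.instance Definition _ i := GRing.isLinear.Build k dform dform _ (euler i) (euler_linear i).

(** Cartan's magic formula, verified by adjoining one generator at a time. On a closed form it
    exhibits [euler i x] as exact. *)
Lemma cartan i x : dd (contract i x) + contract i (dd x) = euler i x.
Proof.
have faCA y z : fa i * (y * z) = y * (fa i * z) by rewrite !mulrA fa_central.
rewrite /contract; elim/form_ind: x => [|c x y IHx IHy||j x IHx|j x IHx].
- by rewrite !(linear0, mulr0) addr0.
- rewrite pdb_linear dd_linear pdb_linear !mulrDr -!scalerAr dd_linear addrACA -scalerDr.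
  by rewrite IHx IHy euler_linear.
- by rewrite /euler dd1 pda1 pdb1 !(mulr0, linear0) addr0.
- transitivity (fa i * ((i == j)%:R *: x) + fa j * euler i x).
    rewrite -IHx pdb_fa faCA !dd_fa linearD /= pdb_fb pdb_fa !mulrDr mulrN.
    by rewrite !(faCA (fb j)) !(faCA (fa j)) addrACA [X in X + _]addrCA subrr addr0.
  rewrite /euler pda_fa pdb_fa !mulrDr faCA -addrA; congr (_ + (_ + _)).
  by rewrite !mulrA fa_central.
transitivity ((i == j)%:R *: (fb i * x) + fb j * euler i x).
  rewrite -IHx pdb_fb dd_fb mulrBr faCA -scalerAr linearN !linearB /= linearZ /= dd_fb opprK.
  rewrite pdb_fb dd_fa !mulrDr !mulrN mulrBr -scalerAr faCA opprB dd_fa scalerDr.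
  by rewrite [LHS](AC (2*2*2) (1*(2*6)*3*4*5))%AC /= subrr addr0 !addrA.
rewrite /euler pda_fb pdb_fb mulrBr mulrDr faCA -scalerAr addrCA; congr (_ + (_ + _)).
by rewrite !mulrA fb_anticomm mulNr.
Qed.

Lemma euler_delta i m : valid q m -> euler i (delta m) = (m.1 i + m.2 i)%:R *: delta m.
Proof.
move=> /forallP/(_ i)/andP[_ le1]; rewrite /euler pda_delta pdb_delta natrD scalerDl.
rewrite -!scalerAr fa_delta fb_delta scalerA; congr (_ + _).
  have [->|m0] := posnP (m.1 i); first by rewrite !scale0r.
  by rewrite ea_sub.
case: (posnP (m.2 i)) => [->|m0]; first by rewrite !(mul0r, scale0r).
have -> : m.2 i = 1%N by apply/eqP; rewrite eqn_leq le1.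
rewrite eb_sub // mul1r -[in X in X * _](eb_sub m0) inv2Dr inv2_eb ltnn add0n.
by rewrite -exprD addnn -mul2n exprM sqrrN !expr1n.
Qed.

End ExteriorDerivative.

(** * Cartier's formula *)

Section Cartier.
Variables (k : fieldType) (q n : nat).
Hypotheses (char_k : q.+1 \in [pchar k]) (q_gt1 : (1 < q)%N).
Local Notation dform := (dform k q n).
Local Notation expo := (expo n).
Local Notation delta := (@delta k q n).
Local Notation fa := (@fa k q n).
Local Notation fb := (@fb k q n).
Local Notation grade := (@grade k q n).
Local Notation dd := (@dd k q n).
Implicit Types (i j : 'I_n) (m : expo) (x y z u v : dform).

Lemma two_neq0 : 2%:R != 0 :> k.
Proof.
rewrite -(dvdn_pcharf char_k); apply: contraL q_gt1 => /dvdn_leq -/(_ isT).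
by rewrite ltnS -ltnNge ltnS.
Qed.

Lemma eqN_dform0 x : x = - x -> x = 0.
Proof.
move=> /eqP; rewrite -addr_eq0 -mulr2n -scaler_nat scaler_eq0 (negbTE two_neq0).
by move/eqP.
Qed.

Lemma grade_coef x w : grade x w = (-1) ^+ bdeg (expo_of w) * x w.
Proof.
elim/form_linear_ind: x => [|c x y IHx IHy|m _].
- by rewrite linear0 ffunE mulr0.
- by rewrite grade_linear !ffunE IHx IHy mulrDr /GRing.scale /= mulrCA.
rewrite grade_delta !ffunE /GRing.scale /=; case: eqP => [<-|] //.
by rewrite !mulr0.
Qed.

Lemma even_coef x w : grade x = x -> x w != 0 -> ~~ odd (bdeg (expo_of w)).
Proof.
move=> ev nz; apply: contraNN nz => od.
have := grade_coef x w; rewrite ev -signr_odd od expr1 mulN1r => /eqP.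
by rewrite -addr_eq0 -mulr2n -mulr_natl mulf_eq0 (negbTE two_neq0).
Qed.

Lemma odd_coef x w : grade x = - x -> x w != 0 -> odd (bdeg (expo_of w)).
Proof.
move=> od nz; apply: contraR nz => ev.
have := grade_coef x w; rewrite od -signr_odd (negbTE ev) expr0 mul1r ffunE => /esym/eqP.
by rewrite -addr_eq0 -mulr2n -mulr_natl mulf_eq0 (negbTE two_neq0).
Qed.

Lemma grade_exp u r : grade u = u -> grade (u ^+ r) = u ^+ r.
Proof.
by move=> ev; elim: r => [|r IHr]; rewrite ?expr0 ?grade1 // exprS gradeM ev IHr.
Qed.

Lemma even_comm u v : grade u = u -> GRing.comm u v.
Proof. exact: even_central. Qed.

Lemma dd_exp u r : grade u = u -> dd (u ^+ r.+1) = r.+1%:R *: (u ^+ r * dd u).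
Proof.
move=> ev; elim: r => [|r IHr]; first by rewrite expr1 expr0 mul1r scale1r.
rewrite exprS ddM // IHr ev -scalerAr mulrA -exprS -[in RHS]natr1 scalerDl scale1r.
by rewrite addrC -(even_central _ (grade_exp r.+1 ev)).
Qed.

(* [(u + v) ^ p - u ^ p - v ^ p] divided by [p]. *)
Definition frob_defect u v :=
  \sum_(i < q) ('C(q.+1, i.+1) %/ q.+1)%:R *: (u ^+ i.+1 * v ^+ (q - i)).

(** The factor p produced by differentiating p-th powers cancels the division by p. The cancellation
    happens in the naturals: C(p, i+1)/p times either exponent is a binomial coefficient of q. *)
Lemma dd_frob_defect u v : grade u = u -> grade v = v ->
  dd (frob_defect u v)
    = (u + v) ^+ q * dd (u + v) - u ^+ q * dd u - v ^+ q * dd v.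
Proof.
move=> evu evv.
have p_pr : prime q.+1 by case/andP: char_k.
have p_gt0 : (0 < q.+1)%N by [].
have uv r s : u ^+ r * v ^+ s = v ^+ s * u ^+ r.
  exact/even_central/grade_exp.
have bin1 (i : 'I_q) : ('C(q.+1, i.+1) %/ q.+1 * i.+1 = 'C(q, i))%N.
  apply/eqP; rewrite -(eqn_pmul2l p_gt0) mulnA [(q.+1 * _)%N]mulnC divnK ?prime_dvd_bin ?ltnS ?ltn_ord //.
  by rewrite mulnC -mul_bin_diag.
have bin2 (i : 'I_q) : ('C(q.+1, i.+1) %/ q.+1 * (q - i) = 'C(q, i.+1))%N.
  apply/eqP; rewrite -(eqn_pmul2l p_gt0) mulnA [(q.+1 * _)%N]mulnC divnK ?prime_dvd_bin ?ltnS ?ltn_ord //.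
  by rewrite mulnC -subSS -mul_bin_down.
have term (i : 'I_q) : dd (('C(q.+1, i.+1) %/ q.+1)%:R *: (u ^+ i.+1 * v ^+ (q - i)))
    = (v ^+ (q - i) * u ^+ i) *+ 'C(q, i) * dd u
      + (v ^+ (q - i.+1) * u ^+ i.+1) *+ 'C(q, i.+1) * dd v.
  have lt_iq := ltn_ord i.
  rewrite linearZ /= ddM // grade_exp // -(subnSK lt_iq) !dd_exp //.
  rewrite -!scalerAl -!scalerAr scalerDr !scalerA -!natrM bin1 subnSK // bin2 !scaler_nat.
  have e1 : u ^+ i * dd u * v ^+ (q - i) = v ^+ (q - i) * u ^+ i * dd u.
    by rewrite -[LHS]mulrA -(even_central (dd u) (grade_exp (q - i) evv)) [LHS]mulrA uv.
  have e2 : u ^+ i.+1 * (v ^+ (q - i.+1) * dd v) = v ^+ (q - i.+1) * u ^+ i.+1 * dd v.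
    by rewrite [LHS]mulrA uv.
  by rewrite e1 e2 !mulrnAl.
have expuv : (u + v) ^+ q = \sum_(i < q.+1) (v ^+ (q - i) * u ^+ i) *+ 'C(q, i).
  by rewrite addrC (exprDn_comm q (even_comm u evv)).
(* The terms with du lack only the index q of the expansion of (u + v)^q, those with dv only the
   index 0. *)
have sum_u : \sum_(i < q) (v ^+ (q - i) * u ^+ i) *+ 'C(q, i) = (u + v) ^+ q - u ^+ q.
  by rewrite expuv big_ord_recr /= subnn expr0 mul1r binn mulr1n addrK.
have sum_v : \sum_(i < q) (v ^+ (q - i.+1) * u ^+ i.+1) *+ 'C(q, i.+1) = (u + v) ^+ q - v ^+ q.
  by rewrite expuv big_ord_recl /= subn0 expr0 mulr1 bin0 mulr1n addrC addKr.
rewrite /frob_defect linear_sum /= (eq_bigr _ (fun (i : 'I_q) _ => term i)) big_split /=.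
by rewrite -!mulr_suml sum_u sum_v linearD /= !mulrBl mulrDr addrACA addrA.
Qed.

Definition theta i : dform := fb i * fa i ^+ q.

(** Formally u^q du is d(u^p)/p, the inverse Cartier operator applied to du, and [theta j] is the
    same expression for a_j. *)
Definition cartier_class u := exists (eta : dform) (c : 'I_n -> k),
  u ^+ q * dd u = dd eta + \sum_j c j *: theta j.

(** Bundled so as to be stable under addition; the conditions then need checking on single monomials
    only. *)
Definition cartier_good u := [/\ grade u = u, u ^+ q.+1 = 0 & cartier_class u].

Lemma cartier_good0 : cartier_good 0.
Proof.
split; rewrite ?linear0 ?exprS ?mul0r //.
exists 0, (fun=> 0); rewrite !linear0 mulr0 big1 ?addr0 // => j _.
by rewrite scale0r.
Qed.

Lemma cartier_goodD u v : cartier_good u -> cartier_good v -> cartier_good (u + v).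
Proof.
case=> evu u0 [eu [cu def_u]] [evv v0 [ev [cv def_v]]]; split.
- by rewrite linearD /= evu evv.
- have char_form : q.+1 \in [pchar dform] by rewrite pchar_lalg.
  have := pFrobenius_autD_comm char_form (even_comm v evu).
  by rewrite !pFrobenius_autE u0 v0 addr0.
(* The map sending u to u^q du is additive up to the differential of [frob_defect], which joins the
   primitive. *)
exists (frob_defect u v + (eu + ev)), (fun j => cu j + cv j).
rewrite [dd (frob_defect u v + _)]linearD /= dd_frob_defect // [dd (eu + ev)]linearD /=.
rewrite (eq_bigr (fun j => cu j *: theta j + cv j *: theta j)) => [|j _]; last exact: scalerDl.
rewrite big_split /= -addrA [dd eu + _ + _]addrACA -def_u -def_v.
by rewrite -[_ - _ - _]addrA -opprD subrK.
Qed.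

Lemma cartier_good_delta (c : k) m :
  m != 0 -> ~~ odd (bdeg m) -> cartier_good (c *: delta m).
Proof.
move=> nz ev.
have evd : grade (c *: delta m) = c *: delta m.
  by rewrite linearZ /= grade_delta -signr_odd (negbTE ev) expr0 scale1r.
have pos_q : (0 < q)%N by apply: ltnW.
(* A monomial containing some b_i has square 0, hence q-th power 0 because q > 1. *)
have [/existsP[i bi]|/existsPn b0] := boolP [exists i, m.2 i != 0%N].
  have sq0 : (c *: delta m) ^+ 2 = 0.
    rewrite exprZn [delta m ^+ 2]expr2 deltaM delta_invalid ?scaler0 //.
    apply/forallPn; exists i; rewrite !ffunE negb_and -!ltnNge; apply/orP; right.
    by case: (m.2 i) bi => // r _; apply: (leq_add (ltn0Sn r) (ltn0Sn r)).
  have powq : (c *: delta m) ^+ q = 0 by rewrite -[X in _ ^+ X](subnK q_gt1) exprD sq0 mulr0.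
  split => //; first by rewrite exprS powq mulr0.
  exists 0, (fun=> 0); rewrite powq mul0r linear0 big1 ?addr0 // => j _.
  by rewrite scale0r.
have m20 : m.2 = 0 by apply/ffunP => i; rewrite ffunE; apply/eqP; have := b0 i; rewrite negbK.
have expd r : delta m ^+ r = delta (m *+ r).
  by elim: r => [|r IHr]; rewrite ?expr0 ?mulr0n // exprS IHr deltaM m20 inv20l scale1r mulrS.
have mulm r i : (m *+ r).1 i = (r * m.1 i)%N.
  by elim: r => [|r IHr]; rewrite ?mulr0n ?mulrS !ffunE // -/((m *+ r).1 i) IHr mulSn.
have [i ai] : exists i, (0 < m.1 i)%N.
  apply/existsP; apply: contraNT nz => /existsPn a0; apply/eqP.
  case: m m20 a0 {ev evd b0 expd mulm} => a b /= -> a0; congr (_, _); apply/ffunP => i.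
  by rewrite ffunE; apply/eqP; rewrite -leqn0 leqNgt a0.
have pow0 : (c *: delta m) ^+ q.+1 = 0.
  rewrite exprZn expd delta_invalid ?scaler0 //; apply/forallPn; exists i.
  by rewrite mulm negb_and -!ltnNge leq_pmulr.
split => //.
have m2r r : (m *+ r).2 = 0.
  elim: r => [|r IHr]; first by rewrite mulr0n.
  by rewrite mulrS; apply: etrans (congr2 +%R m20 IHr) _; rewrite addr0.
have tm j : delta m ^+ q * (fb j * pda j (delta m))
    = (m.1 j)%:R *: (fb j * delta (m *+ q + sub_ea j m)).
  rewrite pda_delta // -!scalerAr expd; congr (_ *: _).
  rewrite mulrA fb_grade -mulrA grade_delta.
  have -> : bdeg (m *+ q) = 0%N by rewrite /bdeg big1 // => l _; rewrite m2r ffunE.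
  by rewrite expr0 scale1r deltaM m2r inv20l scale1r.
(* For a pure a-monomial the a-exponent of the j-th term is p m - e_j. It exceeds q somewhere, or
   the coefficient [m.1 j] is 0, unless m = e_j, when the term is c^p [theta j]. *)
exists 0, (fun j => if m == ea j then c ^+ q.+1 else 0).
rewrite linear0 add0r exprZn linearZ /= -scalerAl -scalerAr scalerA -exprSr ddE mulr_sumr scaler_sumr.
apply: eq_bigr => j _; rewrite tm; case: eqP => [->|/eqP neq].
  rewrite !ffunE eqxx scale1r; congr (_ *: (_ * _)); rewrite fa_exp; congr delta.
  by rewrite -[X in sub_ea _ X]addr0 sub_eaK addr0.
rewrite scale0r; have [->|aj] := posnP (m.1 j); first by rewrite scale0r scaler0.
suff -> : delta (m *+ q + sub_ea j m) = 0 by rewrite mulr0 !scaler0.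
apply: delta_invalid; apply/forallPn.
have [/existsP[l /andP[nlj al]]|/existsPn al0] := boolP [exists l, (l != j) && (0 < m.1 l)%N].
  exists l; rewrite negb_and -!ltnNge; apply/orP; left.
  rewrite [X in (_ < X)%N]ffunE mulm ffunE (negbTE nlj) subn0.
  by rewrite [_ + _]addnC -mulSn leq_pmulr.
exists j; rewrite negb_and -!ltnNge; apply/orP; left.
rewrite [X in (_ < X)%N]ffunE mulm ffunE eqxx subn1.
suff : (1 < m.1 j)%N.
  by case: (m.1 j) => [|[|r]] //= _; rewrite [_ + _]/(_ + _)%N; lia.
rewrite ltn_neqAle aj andbT eq_sym; apply: contraNneq neq => aj1; apply/eqP.
case: m m20 aj1 al0 {ev evd b0 expd mulm ai pow0 tm aj nz m2r} => a b /= -> aj1 al0; congr (_, _).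
apply/ffunP => l; rewrite ffunE; case: eqP => [->|/eqP nlj]; first by rewrite aj1.
by apply/eqP; rewrite -leqn0 leqNgt; have := al0 l; rewrite nlj.
Qed.

Definition aug x : k := x (mono_of q 0).

Lemma even_pos_good u : grade u = u -> aug u = 0 -> cartier_good u.
Proof.
move=> ev au; rewrite (formE u); apply: (big_ind cartier_good).
- exact: cartier_good0.
- exact: cartier_goodD.
move=> w _; have [->|nz] := eqVneq (u w) 0.
  by rewrite scale0r; apply: cartier_good0.
apply: cartier_good_delta; last exact: even_coef nz.
by apply: contraNneq nz => w0; rewrite -(expo_ofK w) w0; apply/eqP.
Qed.

End Cartier.

(** * Forms that are exact up to low [b]-degree, and the elements w + dw *)

Section ExactModuloLowDegree.
Variables (k : fieldType) (q n : nat).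
Hypotheses (char_k : q.+1 \in [pchar k]) (q_gt1 : (1 < q)%N).
Local Notation dform := (dform k q n).
Local Notation delta := (@delta k q n).
Local Notation fa := (@fa k q n).
Local Notation fb := (@fb k q n).
Local Notation grade := (@grade k q n).
Local Notation dd := (@dd k q n).
Local Notation theta := (@theta k q n).
Implicit Types (i j : 'I_n) (m : expo n) (x y z u v : dform).

Definition bdeg_le r y := forall w, y w != 0 -> (bdeg (expo_of w) <= r)%N.

Lemma bdeg_le0 r : bdeg_le r 0.
Proof. by move=> w; rewrite ffunE eqxx. Qed.

Lemma bdeg_leP r c x y : bdeg_le r x -> bdeg_le r y -> bdeg_le r (c *: x + y).
Proof.
move=> bx bY w; rewrite !ffunE; have [/bx //|/negPn/eqP ->] := boolP (x w != 0).
by rewrite scaler0 add0r; apply: bY.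
Qed.

Lemma bdeg_le_delta r m : (bdeg m <= r)%N -> bdeg_le r (delta m).
Proof. by move=> le_m w; rewrite ffunE; case: (expo_of w =P m) => [->|_] //; rewrite eqxx. Qed.

Lemma bdeg_le_ind r (P : dform -> Prop) :
    P 0 -> (forall c x y, P x -> P y -> P (c *: x + y)) ->
    (forall m, (bdeg m <= r)%N -> P (delta m)) -> forall y, bdeg_le r y -> P y.
Proof.
move=> P0 PD Pd y ley; rewrite (formE y); elim/big_rec: _ => // w z _ Pz.
have [->|nz] := eqVneq (y w) 0; first by rewrite scale0r add0r.
by apply: PD => //; apply/Pd/ley.
Qed.

Lemma bdeg_le_fa r i y : bdeg_le r y -> bdeg_le r (fa i * y).
Proof.
move: y; apply: bdeg_le_ind => [|c x y IHx IHy|m le_m].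
- by rewrite mulr0; apply: bdeg_le0.
- by rewrite mulrDr -scalerAr; apply: bdeg_leP.
by rewrite fa_delta; apply: bdeg_le_delta; rewrite bdegD bdeg_ea.
Qed.

Lemma bdeg_le_fb r i y : bdeg_le r y -> bdeg_le r.+1 (fb i * y).
Proof.
move: y; apply: bdeg_le_ind => [|c x y IHx IHy|m le_m].
- by rewrite mulr0; apply: bdeg_le0.
- by rewrite mulrDr -scalerAr; apply: bdeg_leP.
rewrite fb_delta -[_ *: _]addr0; apply: bdeg_leP; last exact: bdeg_le0.
by apply: bdeg_le_delta; rewrite bdegD bdeg_eb.
Qed.

Lemma bdeg_le_theta r i y : bdeg_le r y -> bdeg_le r.+1 (theta i * y).
Proof.
move=> ley; rewrite /theta -mulrA; apply: bdeg_le_fb; move: (X in fa i ^+ X) => e.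
by elim: e => [|l IHl]; rewrite ?expr0 ?mul1r // exprS -mulrA; apply: bdeg_le_fa.
Qed.

Lemma dd_theta i : dd (theta i) = 0.
Proof.
have eva := grade_fa1 k q i.
rewrite /theta dd_fb // -[X in fa i ^+ X](prednK (ltnW q_gt1)) dd_exp // dd_fa1 //.
rewrite -scalerAr (even_central _ (grade_exp q.-1 eva)) mulrA fb_sqr mul0r.
by rewrite scaler0 oppr0.
Qed.

Lemma dd_theta_sum (c : 'I_n -> k) : dd (\sum_j c j *: theta j) = 0.
Proof. by rewrite linear_sum big1 // => j _; rewrite linearZ /= dd_theta scaler0. Qed.

(** Closedness of [y] is recorded because it makes [dd eta * y] exact when a further Cartier form is
    multiplied on. *)
Definition exact_mod r x :=
  exists eta y, [/\ x = dd eta + y, dd y = 0 & bdeg_le r y].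

Lemma exact_mod1 : exact_mod 0 1.
Proof.
exists 0, 1; split; rewrite ?linear0 ?add0r ?dd1 // -delta0.
by apply: bdeg_le_delta; rewrite /bdeg big1 // => i _; rewrite ffunE.
Qed.

Lemma exact_modS r x : exact_mod r x -> exact_mod r.+1 x.
Proof.
by case=> eta [y [-> dy le_y]]; exists eta, y; split => // w /le_y/leq_trans; apply.
Qed.

Lemma exact_mod_cartier r u x : cartier_good u -> exact_mod r x ->
  exact_mod r.+1 (u ^+ q * dd u * x).
Proof.
case=> evu _ [eta [c def_u]] [eta' [y [-> dy le_y]]].
have odd_tau : grade (u ^+ q * dd u) = - (u ^+ q * dd u).
  by rewrite gradeM grade_exp // grade_dd // evu mulrN.
have dtau : dd (u ^+ q * dd u) = 0.
  by rewrite def_u linearD /= ddd // dd_theta_sum addr0.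
have dt z : dd z = 0 -> dd ((\sum_j c j *: theta j) * z) = 0.
  by move=> dz; rewrite ddM // dz mulr0 addr0 dd_theta_sum mul0r.
(* Write t = u^q du = d eta + s with s the sum of the thetas. As t is odd and closed and y is
   closed, t x = d(eta y) - d(t eta') + s y. *)
exists (eta * y - u ^+ q * dd u * eta'), ((\sum_j c j *: theta j) * y); split.
- rewrite linearB /= ddM // [dd (_ * eta')]ddM // dy mulr0 addr0 dtau mul0r add0r odd_tau.
  by rewrite mulNr opprK mulrDr [dd eta * y + _]addrC -addrA -mulrDl -def_u.
- exact: dt.
rewrite mulr_suml; apply: (big_ind (bdeg_le r.+1)) => [|x1 x2|j _]; first exact: bdeg_le0.
  by move=> le1 le2; rewrite -[x1]scale1r; apply: bdeg_leP.
by rewrite -scalerAl -[_ *: _]addr0; apply: bdeg_leP (bdeg_le0 _); apply: bdeg_le_theta.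
Qed.

(** The top monomial has [b]-degree n, out of reach of the remainder, and exact forms do not contain
    it. *)
Lemma exact_mod_top r x : (r < n)%N -> exact_mod r x -> x (top_mono q n) = 0.
Proof.
move=> lt_rn [eta [y [-> _ le_y]]]; rewrite ffunE dd_top // add0r.
apply/eqP; apply: contraTT lt_rn => /le_y; rewrite -leqNgt.
rewrite /bdeg (eq_bigr (fun=> 1%N)) => [|i _]; last by rewrite !ffunE.
by rewrite sum_nat_const card_ord muln1.
Qed.

Lemma aug_delta m : aug (delta m) = (m == 0)%:R.
Proof. by rewrite /aug ffunE mono_ofK ?valid0 // eq_sym. Qed.

Lemma aug_linear c x y : aug (c *: x + y) = c * aug x + aug y.
Proof. by rewrite /aug !ffunE. Qed.

Lemma aug0 : aug (0 : dform) = 0.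
Proof. by rewrite /aug ffunE. Qed.

Lemma aug_fa i x : aug (fa i * x) = 0.
Proof.
elim/form_linear_ind: x => [|c x y IHx IHy|m _]; first by rewrite mulr0 aug0.
  by rewrite mulrDr -scalerAr aug_linear IHx IHy mulr0 addr0.
rewrite fa_delta aug_delta; case: eqP => // /(congr1 (@edeg n)); rewrite edegD edeg_ea.
by rewrite /edeg [RHS]big1 // => j _; rewrite !ffunE.
Qed.

Lemma aug_fb i x : aug (fb i * x) = 0.
Proof.
elim/form_linear_ind: x => [|c x y IHx IHy|m _]; first by rewrite mulr0 aug0.
  by rewrite mulrDr -scalerAr aug_linear IHx IHy mulr0 addr0.
rewrite fb_delta -[_ *: _]addr0 aug_linear aug_delta aug0; case: eqP => [|_]; last first.
  by rewrite mulr0 addr0.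
move=> /(congr1 (@edeg n)); rewrite edegD edeg_eb.
by rewrite /edeg [RHS]big1 // => j _; rewrite !ffunE.
Qed.

Lemma augM x y : aug (x * y) = aug x * aug y.
Proof.
elim/form_ind: x => [|c x x' IH IH'||i x _|i x _].
- by rewrite mul0r aug0 mul0r.
- by rewrite mulrDl -scalerAl !aug_linear IH IH' mulrDl mulrA.
- by rewrite mul1r -delta0 aug_delta eqxx mul1r.
- by rewrite -mulrA !aug_fa mul0r.
- by rewrite -mulrA !aug_fb mul0r.
Qed.

Lemma aug_dd x : aug (dd x) = 0.
Proof.
rewrite ddE; elim/big_rec: _ => [|i y _ IHy]; first exact: aug0.
by rewrite -[fb i * _]scale1r aug_linear IHy aug_fb mulr0 addr0.
Qed.

(* The subalgebra generated by the a_i + b_i consists of such elements. *)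
Definition fedosov x := exists w, [/\ grade w = w, aug w = 0 & x = w + dd w].

Lemma fedosov0 : fedosov 0.
Proof. by exists 0; rewrite !linear0 aug0 addr0. Qed.

Lemma fedosovP c x y : fedosov x -> fedosov y -> fedosov (c *: x + y).
Proof.
case=> w [ev aw ->] [w' [ev' aw' ->]]; exists (c *: w + w'); split.
- by rewrite grade_linear ev ev'.
- by rewrite aug_linear aw aw' mulr0 addr0.
by rewrite dd_linear scalerDr addrACA.
Qed.

Lemma fedosovM x y : fedosov x -> fedosov y -> fedosov (x * y).
Proof.
case=> w [ev aw ->] [w' [ev' aw' ->]]; exists (w * w' + dd w * dd w'); split.
- by rewrite linearD /= !gradeM !grade_dd // ev ev' mulrNN.
- by rewrite -[w * w']scale1r aug_linear !augM aw aug_dd !mul0r mulr0 addr0.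
rewrite linearD /= !ddM // !ddd // mul0r mulr0 !addr0 ev.
rewrite mulrDl !mulrDr.
have E (a b c d : dform) : a + b + (c + d) = a + d + (c + b).
  by rewrite -!addrA; congr (a + _); rewrite addrCA [b + d]addrC addrCA.
exact: E.
Qed.

Lemma fedosov_gen i : fedosov (fa i + fb i).
Proof.
by exists (fa i); rewrite grade_fa1 dd_fa1 // -[fa i]mulr1 aug_fa.
Qed.

End ExactModuloLowDegree.

(** * Euler homotopy: reduction of closed forms to weights divisible by p *)

Section Homotopy.
Variables (k : fieldType) (q n : nat).
Hypotheses (char_k : q.+1 \in [pchar k]) (q_gt1 : (1 < q)%N).
Local Notation dform := (dform k q n).
Local Notation dd := (@dd k q n).
Local Notation euler := (@euler k q n).
Implicit Types (i : 'I_n) (x y : dform) (w : mono q n).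

Definition weight i w : nat := ((expo_of w).1 i + (expo_of w).2 i)%N.

Lemma dform_coefP c x y w : (c *: x + y) w = c * x w + y w.
Proof. by rewrite !ffunE. Qed.

Lemma euler_coef i x w : euler i x w = (weight i w)%:R * x w.
Proof.
elim/form_linear_ind: x => [|c x y IHx IHy|m vm].
- by rewrite linear0 !ffunE mulr0.
- by rewrite euler_linear !dform_coefP IHx IHy mulrDr mulrCA.
rewrite euler_delta // -[_ *: _]addr0 dform_coefP [delta _ _ _ _]ffunE ffunE addr0.
by case: (expo_of w =P m) => [<-|]; rewrite ?mulr0.
Qed.

Definition closed_mod (x y : dform) := dd y = 0 /\ exists eta, x = dd eta + y.

Lemma dd_euler i x : dd x = 0 -> dd (euler i x) = 0.
Proof.
move=> dx; rewrite -cartan // dx /contract linear0 mulr0 addr0.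
by rewrite ddd.
Qed.

Lemma iter_euler_exact i x r : dd x = 0 -> exists eta, iter r.+1 (euler i) x = dd eta.
Proof.
move=> dx; have dxr : dd (iter r (euler i) x) = 0 by elim: r => [|r IHr] //=; apply: dd_euler.
exists (contract i (iter r (euler i) x)).
by rewrite iterS -cartan // dxr /contract linear0 mulr0 addr0.
Qed.

Lemma iter_euler_coef i x w r : iter r (euler i) x w = (weight i w)%:R ^+ r * x w.
Proof.
by elim: r => [|r IHr]; rewrite ?expr0 ?mul1r // iterS euler_coef IHr mulrA -exprS.
Qed.

(* By Fermat, x - euler i ^ q x keeps the monomials whose weight in the i-th
   pair of variables is a multiple of p = q + 1 and kills the others. *)
Definition keep_mod (s : seq 'I_n) x := foldr (fun i y => y - iter q (euler i) y) x s.

Lemma keep_mod_exact s x : dd x = 0 -> closed_mod x (keep_mod s x).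
Proof.
move=> dx; elim: s => [|i s [dy [eta def_x]]] /=; first by split => //; exists 0; rewrite linear0 add0r.
have [eta' def_y] := iter_euler_exact i q.-1 dy; rewrite prednK ?(ltnW q_gt1) // in def_y.
split; first by rewrite linearB /= dy def_y ddd // subr0.
by exists (eta + eta'); rewrite linearD /= {1}def_x -def_y -addrA; congr (_ + _); rewrite addrC subrK.
Qed.

Lemma keep_mod_coef s x w i : i \in s -> keep_mod s x w != 0 -> (weight i w)%:R = 0 :> k.
Proof.
elim: s => //= j s IHs; rewrite inE !ffunE iter_euler_coef -[X in X - _]mul1r -mulrBl mulf_eq0 negb_or.
case/predU1P => [->|/IHs IH] /andP[]; last by move=> _; apply: IH.
(* The weight is fixed by Frobenius; if it were nonzero in k, its q-th power would be 1 and the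
   coefficient would have been killed. *)
rewrite subr_eq0 => neq1 _; apply/eqP; apply: contraNT neq1 => nz.
apply/eqP/(mulIf nz); rewrite mul1r -exprSr.
by have := pFrobenius_aut_nat char_k (weight j w); rewrite pFrobenius_autE => ->.
Qed.

(** The weight is at most q + 1 = p, so it is 0 or p, and p is reached only by a_i^q b_i. *)
Lemma weight_mod0 i w : (weight i w)%:R = 0 :> k ->
  ((expo_of w).1 i = 0%N /\ (expo_of w).2 i = 0%N) \/
  ((expo_of w).1 i = q /\ (expo_of w).2 i = 1%N).
Proof.
move/eqP; rewrite -(dvdn_pcharf char_k) /weight => /dvdnP[r].
have /forallP/(_ i)/andP[] := valid_expo_of w.
move: ((expo_of w).1 i) ((expo_of w).2 i) => a b.
by case: r => [|[|r]]; rewrite ?mul0n ?mul1n ?mulSn => *; lia.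
Qed.

End Homotopy.

(** * Substitution of even forms and their differentials *)

Section FormSubstitution.
Variables (k : fieldType) (q m n : nat).
Hypotheses (char_k : q.+1 \in [pchar k]) (q_gt1 : (1 < q)%N).
Variable u : 'I_m -> dform k q n.
Hypotheses (u_even : forall i, grade (u i) = u i) (u_aug : forall i, aug (u i) = 0).

Let u_good i : cartier_good (u i).
Proof. exact: even_pos_good. Qed.

Let du_odd i : grade (dd (u i)) = - dd (u i).
Proof. by rewrite grade_dd // u_even. Qed.

Lemma subst_uu i j : u i * u j = u j * u i.
Proof. exact: even_central. Qed.

Lemma subst_uv i j : u i * dd (u j) = dd (u j) * u i.
Proof. exact: even_central. Qed.

Lemma subst_u_nilp i : u i ^+ q.+1 = 0.
Proof. by case: (u_good i). Qed.

Lemma subst_vv i j : dd (u i) * dd (u j) = - (dd (u j) * dd (u i)).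
Proof. by rewrite (odd_grade _ (du_odd i)) du_odd mulNr. Qed.

Lemma subst_v_sqr i : dd (u i) * dd (u i) = 0.
Proof. exact/(eqN_dform0 char_k q_gt1)/subst_vv. Qed.

Definition form_map : dform k q m -> dform k q n := form_subst u (fun i => dd (u i)).

Lemma form_map_linear : linear form_map.
Proof. exact: lext_linear. Qed.

HB.instance Definition _ :=
  GRing.isLinear.Build k (dform k q m) (dform k q n) _ form_map form_map_linear.

Lemma form_map_monoid : monoid_morphism form_map.
Proof.
exact: (form_subst_monoid subst_uu subst_uv subst_u_nilp subst_vv subst_v_sqr).
Qed.

Lemma form_map1 : form_map 1 = 1.
Proof. exact: form_map_monoid.1. Qed.

Lemma form_mapM x y : form_map (x * y) = form_map x * form_map y.
Proof. exact: form_map_monoid.2. Qed.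

Lemma form_map_fa i : form_map (fa k q i) = u i.
Proof. exact: (form_subst_fa subst_u_nilp subst_v_sqr). Qed.

Lemma form_map_fb i : form_map (fb k q i) = dd (u i).
Proof. exact: (form_subst_fb subst_u_nilp subst_v_sqr). Qed.

(** Substitution acts as a pullback of forms; on generators the claim is the choice of [dd (u i)] as
    the image of b_i. *)
Lemma form_map_dd x : form_map (dd x) = dd (form_map x).
Proof.
elim/form_ind: x => [|c x y IHx IHy||i x IHx|i x IHx].
- by rewrite !linear0.
- by rewrite dd_linear !form_map_linear dd_linear IHx IHy.
- by rewrite form_map1 !dd1 // linear0.
- by rewrite dd_fa // linearD /= !form_mapM IHx form_map_fa form_map_fb ddM // u_even.
by rewrite dd_fb // linearN /= !form_mapM IHx form_map_fb ddM // ddd // mul0r add0r du_odd mulNr.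
Qed.

(** Each pair contributes 1 or the Cartier form u_i^q du_i, and each such form raises the degree
    bound by one. *)
Lemma eval_expo_exact_mod (w : mono q m) :
  (forall i, ((expo_of w).1 i = 0%N /\ (expo_of w).2 i = 0%N) \/
             ((expo_of w).1 i = q /\ (expo_of w).2 i = 1%N)) ->
  exact_mod m (form_map (delta k q (expo_of w))).
Proof.
move=> wP; rewrite /form_map (form_subst_delta subst_u_nilp subst_v_sqr) /eval_expo.
(* Reading the bound as the length of the index list makes it follow the induction on that list. *)
rewrite -[X in exact_mod X](_ : size (index_enum 'I_m) = m); last first.
  by rewrite [index_enum _]unlock -enumT size_enum_ord.
elim: (index_enum _) => [|i s IHs]; first by rewrite big_nil; apply: exact_mod1.
rewrite big_cons; case: (wP i) => -[-> ->].
  by rewrite !expr0 !mul1r; apply: exact_modS.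
by rewrite expr1; apply: exact_mod_cartier.
Qed.

(** The homotopy leaves an exact form, whose image is exact, and monomials in the a_i^q b_i, whose
    images have [b]-degree at most m modulo exact forms. *)
Lemma closed_map_top x : (m < n)%N -> dd x = 0 -> form_map x (top_mono q n) = 0.
Proof.
move=> lt_mn dx; have [_ [eta ->]] := keep_mod_exact char_k q_gt1 (index_enum 'I_m) dx.
rewrite linearD /= form_map_dd ffunE dd_top // add0r.
set y := keep_mod _ _; rewrite (formE y) linear_sum sum_ffunE big1 // => w _.
rewrite linearZ ffunE /=; have [->|nz] := eqVneq (y w) 0; first by rewrite scale0r.
rewrite (exact_mod_top char_k lt_mn) ?scaler0 //; apply: eval_expo_exact_mod => i.
by apply/(weight_mod0 char_k)/(keep_mod_coef char_k _ nz)/mem_index_enum.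
Qed.

End FormSubstitution.

(** * The Grassmann algebra *)

HB.lock Definition monG (k : comNzRingType) (A : monomG) : grassmann0 k := << A >>.

HB.lock Definition gG (k : comNzRingType) (i : nat) : unitized (grassmann0 k) :=
  inU (genG k i).

Section GrassmannCommutators.
Variable k : comNzRingType.
Implicit Types A B C : monomG.
Local Notation monG := (monG k).

Lemma monGM A B : nmul (monG A) (monG B) = signG k A B *: monG (monomG_U A B).
Proof.
rewrite unlock; have := @grassmann_mulUU k 1 1 A B; rewrite !mulr1 => ->.
by have := malgZU (signG k A B) 1 (monomG_U A B); rewrite mulr1 => <-.
Qed.

Lemma grassmann_ind (P : grassmann0 k -> Prop) :
    P 0 -> (forall a f g, P f -> P g -> P (a *: f + g)) ->
    (forall A, P (monG A)) -> forall f, P f.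
Proof.
by move=> P0 PD PU; apply: malg_linear_ind => // A; have := PU A; rewrite unlock.
Qed.

(** Each pair (a, b) is an inversion in exactly one of the two orders. *)
Lemma inversionsC (A B : {fset nat}) : [disjoint A & B]%fset ->
  (inversions A B + inversions B A = #|` A| * #|` B|)%N.
Proof.
move=> dAB; rewrite /inversions [X in (_ + X)%N]exchange_big /= -big_split /=.
rewrite big_seq (eq_bigr (fun=> #|` B|)) => [|a aA].
  by rewrite -big_seq big_const_seq iter_addn_0 count_predT mulnC.
rewrite -big_split /= big_seq (eq_bigr (fun=> 1%N)) => [|b bB].
  by rewrite -big_seq big_const_seq iter_addn_0 count_predT mul1n.
case: ltngtP => // eq_ab; have := fdisjointP dAB _ aA.
by rewrite -eq_ab bB.
Qed.

Lemma signGC A B : signG k A B = (-1) ^+ (#|` val A| * #|` val B|) * signG k B A.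
Proof.
rewrite /signG [in RHS]fdisjoint_sym; case: ifP => [dAB|_]; last by rewrite mulr0.
rewrite -(inversionsC dAB) exprD -mulrA -exprD addnn -mul2n exprM sqrrN !expr1n.
by rewrite mulr1.
Qed.

Lemma monomG_UC A B : monomG_U A B = monomG_U B A.
Proof. by apply: val_inj; rewrite /= fsetUC. Qed.

Lemma monG_comm A B : ~~ (odd #|` val A| && odd #|` val B|) ->
  nmul (monG A) (monG B) = nmul (monG B) (monG A).
Proof.
move=> ev; rewrite !monGM monomG_UC signGC -signr_odd oddM (negbTE ev).
by rewrite expr0 mul1r.
Qed.

(** Basis elements fail to commute only if both have odd length; their product is then 0 or of even
    length, hence central. *)
Lemma monG_commutator A B C :
  let c := nmul (monG A) (monG B) - nmul (monG B) (monG A) in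
  nmul c (monG C) = nmul (monG C) c.
Proof.
case: (boolP (odd #|` val A| && odd #|` val B|)) => [odAB|ev] /=; last first.
  by rewrite monG_comm // subrr nmul0l nmul0r.
rewrite !monGM (monomG_UC B A) -scalerBl nmulZl nmulZr.
case: (boolP [disjoint val A & val B]%fset) => [dAB|ndAB]; last first.
  have s0 : signG k A B = 0 by rewrite /signG (negbTE ndAB).
  by rewrite [signG k B A]signGC s0 mulr0 subrr !scale0r.
rewrite monG_comm //=; apply/nandP; left; case/andP: odAB => odA odB.
have := cardfsUI (val A) (val B).
rewrite (eqP (_ : val A `&` val B == fset0)%fset) ?fdisjoint_fset0 //.
rewrite cardfs0 addn0 => ->.
by rewrite oddD odA odB.
Qed.

Definition lie_nilpotent2 (T : pzRingType) :=
  forall x y z : T, GRing.comm (x * y - y * x) z.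

Lemma grassmann_commutator (x y z : grassmann0 k) :
  let c := nmul x y - nmul y x in nmul c z = nmul z c.
Proof.
pose com (x y : grassmann0 k) := nmul x y - nmul y x.
rewrite -/(com x y) /=.
have comDl c a b d : com (c *: a + b) d = c *: com a d + com b d.
  by rewrite /com nmul_linearl nmul_linearr scalerBr opprD addrACA.
have comDr c a b d : com d (c *: a + b) = c *: com d a + com d b.
  by rewrite /com nmul_linearl nmul_linearr scalerBr opprD addrACA.
elim/grassmann_ind: x => [|a x1 x2 IH1 IH2|A].
- by rewrite /com nmul0l nmul0r subrr nmul0l nmul0r.
- by rewrite comDl nmul_linearl nmul_linearr IH1 IH2.
elim/grassmann_ind: y => [|a y1 y2 IH1 IH2|B].
- by rewrite /com nmul0l nmul0r subrr nmul0l nmul0r.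
- by rewrite comDr nmul_linearl nmul_linearr IH1 IH2.
elim/grassmann_ind: z => [|a z1 z2 IH1 IH2|C].
- by rewrite nmul0l nmul0r.
- by rewrite nmul_linearl nmul_linearr IH1 IH2.
exact: monG_commutator.
Qed.

Lemma unitized_grassmann_nilpotent : lie_nilpotent2 (unitized (grassmann0 k)).
Proof.
move=> x y z.
by rewrite unitized_commutator; apply/inU_comm/grassmann_commutator.
Qed.

Local Notation gG := (gG k).

Lemma gG_anticomm i j : gG i * gG j = - (gG j * gG i).
Proof. by rewrite unlock; apply/inU_anticomm/genG_anticomm. Qed.

Lemma gG_sqr i : gG i * gG i = 0.
Proof. by rewrite unlock; apply/inU_sqr0/genG_sqr. Qed.

Lemma prod_gG r : exists A, (forall a, a \in val A -> (a < r.+1)%N) /\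
  \prod_(i < r.+1) gG i = inU (monG A).
Proof.
elim: r => [|r [A [ltA IHr]]].
  exists (Sub [fset 0%N]%fset (fset1_neq0 0)); split=> [a|]; first by rewrite /= in_fset1 => /eqP ->.
  by rewrite big_ord1 gG.unlock monG.unlock.
exists (monomG_U A (Sub [fset r.+1]%fset (fset1_neq0 r.+1))); split.
  move=> a; rewrite /= in_fsetU in_fset1 => /orP[/ltA|/eqP -> //].
  by move/leq_trans; apply.
rewrite big_ord_recr IHr gG.unlock /= -inU_M; congr inU.
by have := @genG_monom k A r.+1 ltA; rewrite monG.unlock.
Qed.

Lemma monG_neq0 A : monG A != 0.
Proof. by rewrite unlock monalgU_eq0 oner_eq0. Qed.

Lemma prod_gG_neq0 r : \prod_(i < r) gG i != 0.
Proof.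
case: r => [|r]; first by rewrite big_ord0 oner_eq0.
have [A [_ ->]] := prod_gG r; apply: contra (monG_neq0 A) => /eqP.
by rewrite -(linear0 (@inU _ _)) => /inU_inj ->.
Qed.

End GrassmannCommutators.

Section SquareZeroSums.
Variable T : pzRingType.

Lemma exprD_sqr0 (x t : T) e : GRing.comm x t -> t * t = 0 ->
  (x + t) ^+ e.+1 = x ^+ e.+1 + (x ^+ e * t) *+ e.+1.
Proof.
move=> xt tt; elim: e => [|e IHe]; first by rewrite !expr1 expr0 mul1r.
rewrite exprSr IHe mulrDl !mulrDr -!exprSr -addrA; congr (_ + _).
rewrite -mulrnAl -[_ *+ _ * t * t]mulrA tt mulr0 addr0 -mulrA -xt mulrA mulrnAl -exprSr.
by rewrite mulrnAl -mulrS.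
Qed.

(** Only products of distinct [t i] survive in the expansion. With r = q this gives [even_gen] its
    q-th power, where q! is invertible in k. *)
Lemma sum_sqr0_exp (t : nat -> T) r :
    (forall i j, GRing.comm (t i) (t j)) -> (forall i, t i * t i = 0) ->
  (\sum_(i < r) t i) ^+ r = (\prod_(i < r) t i) *+ r`! /\
  (\sum_(i < r) t i) ^+ r.+1 = 0.
Proof.
move=> ct tt; elim: r => [|r [IH1 IH2]]; first by rewrite !big_ord0 expr0 expr1.
have cs : GRing.comm (\sum_(i < r) t i) (t r).
  by apply: commr_sym; apply: commr_sum => i _; apply: ct.
rewrite !big_ord_recr /= !exprD_sqr0 //; split.
  by rewrite IH2 add0r IH1 mulrnAl -mulrnA mulnC -factS.
by rewrite exprS IH2 mulr0 mul0r mul0rn addr0.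
Qed.

Lemma prod_double (F : nat -> T) a r :
  \prod_(s < r) (F (a + s.*2)%N * F (a + s.*2.+1)%N) = \prod_(s < r.*2) F (a + s)%N.
Proof.
elim: r => [|r IHr]; first by rewrite !big_ord0.
by rewrite big_ord_recr IHr doubleS !big_ord_recr /= mulrA.
Qed.

Lemma prod_blocks (F : nat -> T) r l :
  \prod_(i < r) \prod_(s < l) F (i * l + s)%N = \prod_(s < r * l) F s.
Proof.
elim: r => [|r IHr]; first by rewrite !big_ord0.
by rewrite mulSnr big_split_ord big_ord_recr IHr.
Qed.

End SquareZeroSums.

(** * Realization of forms in the Grassmann algebra *)

Section CentralizingSubstitution.
Variables (k : fieldType) (q n : nat).
Hypotheses (char_k : q.+1 \in [pchar k]) (q_gt1 : (1 < q)%N).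
Local Notation T := (unitized (grassmann0 k)).
Local Notation gG := (gG k).

(** Twice this product is a commutator, and commutators are central. *)
Lemma gG_pair_central a b (x : T) : GRing.comm (gG a * gG b) x.
Proof.
have := unitized_grassmann_nilpotent (gG a) (gG b) x.
rewrite (gG_anticomm k b a) opprK -mulr2n -scaler_nat /GRing.comm -scalerAl -scalerAr.
by apply: scalerI; apply: two_neq0 char_k q_gt1.
Qed.

(* The i-th block of 2 q + 1 generators of G_0 yields an even element, the sum
   of q products of two generators, and an odd one, the last generator. *)
Definition even_gen (i : nat) : T :=
  \sum_(s < q) gG (i * (q.*2).+1 + s.*2) * gG (i * (q.*2).+1 + s.*2.+1).
Definition odd_gen (i : nat) : T := gG (i * (q.*2).+1 + q.*2).

Lemma even_gen_central i x : GRing.comm (even_gen i) x.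
Proof.
by apply: commr_sym; apply: commr_sum => s _; apply/commr_sym/gG_pair_central.
Qed.

Lemma even_gen_exp i :
  even_gen i ^+ q = (\prod_(s < q)
    (gG (i * (q.*2).+1 + s.*2) * gG (i * (q.*2).+1 + s.*2.+1))) *+ q`! /\
  even_gen i ^+ q.+1 = 0.
Proof.
apply: (sum_sqr0_exp (t := fun s => gG (i * (q.*2).+1 + s.*2) * gG (i * (q.*2).+1 + s.*2.+1))).
  by move=> a b; apply: gG_pair_central.
by move=> a; rewrite [LHS]mulrA gG_pair_central mulrA gG_sqr !mul0r.
Qed.

Definition to_grassmann : dform k q n -> T :=
  form_subst (fun i => even_gen i) (fun i => odd_gen i).

Lemma to_grassmann_linear : linear to_grassmann.
Proof. exact: lext_linear. Qed.

HB.instance Definition _ :=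
  GRing.isLinear.Build k (dform k q n) T _ to_grassmann to_grassmann_linear.

Lemma to_grassmannD x y : to_grassmann (x + y) = to_grassmann x + to_grassmann y.
Proof. exact: linearD. Qed.

Let even_gen_nilp i : even_gen i ^+ q.+1 = 0.
Proof. exact: (even_gen_exp i).2. Qed.

Let odd_gen_sqr i : odd_gen i * odd_gen i = 0.
Proof. exact: gG_sqr. Qed.

Lemma to_grassmann_monoid : monoid_morphism to_grassmann.
Proof.
apply: form_subst_monoid => [i j|i j|i|i j|i].
- exact: even_gen_central.
- exact: even_gen_central.
- exact: even_gen_nilp.
- exact: gG_anticomm.
- exact: odd_gen_sqr.
Qed.

Lemma to_grassmannM x y : to_grassmann (x * y) = to_grassmann x * to_grassmann y.
Proof. exact: to_grassmann_monoid.2. Qed.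

Lemma to_grassmann_fa i : to_grassmann (fa k q i) = even_gen i.
Proof. exact: (form_subst_fa (fun i => even_gen_nilp i) (fun i => odd_gen_sqr i)). Qed.

Lemma to_grassmann_fb i : to_grassmann (fb k q i) = odd_gen i.
Proof. exact: (form_subst_fb (fun i => even_gen_nilp i) (fun i => odd_gen_sqr i)). Qed.

Definition top_expo : expo n := ([ffun=> q], [ffun=> 1%N]).

Lemma expo_of_top : expo_of (top_mono q n) = top_expo.
Proof. by congr (_, _); apply/ffunP => i; rewrite !ffunE. Qed.

(** The blocks are disjoint, so the image is (q!)^n times the ordered product of the first n(2q + 1)
    generators; q! is invertible as q < p. *)
Lemma to_grassmann_top_neq0 : to_grassmann (delta k q top_expo) != 0.
Proof.
rewrite /to_grassmann (form_subst_delta (fun i => even_gen_nilp i) (fun i => odd_gen_sqr i)).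
have -> : eval_expo (fun i : 'I_n => even_gen i) (fun i => odd_gen i) top_expo
    = \prod_(i < n) ((\prod_(s < q.*2.+1) gG (i * q.*2.+1 + s)) *+ q`!).
  apply: eq_bigr => i _; rewrite !ffunE expr1 (even_gen_exp i).1 mulrnAl.
  by rewrite (prod_double gG) big_ord_recr.
rewrite prodrMn_const card_ord (prod_blocks gG) -scaler_nat scaler_eq0 negb_or.
rewrite prod_gG_neq0 andbT natrX expf_neq0 //.
elim: {-2}q (leqnn q) => [|r IHr] lt_rq; first exact: oner_neq0.
rewrite factS natrM mulf_neq0 ?IHr ?(ltnW lt_rq) //.
by rewrite -(dvdn_pcharf char_k); apply: contraL lt_rq => /dvdn_leq -/(_ isT); rewrite -leqNgt.
Qed.

End CentralizingSubstitution.

(** * Detecting the odd part of a form by commutators *)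

Section Socle.
Variables (k : fieldType) (q n : nat).
Hypotheses (char_k : q.+1 \in [pchar k]) (q_gt1 : (1 < q)%N).
Local Notation dform := (dform k q n).
Local Notation delta := (@delta k q n).
Local Notation rho := (@to_grassmann k q n).
Implicit Types (x y z : dform) (w : mono q n).

(* The top monomial generates the socle; y is moved there by multiplication with
   the complement of one of its monomials of least degree. *)
Lemma exists_complement y : y != 0 ->
  exists w m, [/\ y w != 0, expo_of w + m = top_expo q n
    & exists2 c, c != 0 & y * delta m = c *: delta (top_expo q n)].
Proof.
move=> nz; have [w0 nz0] : exists w, y w != 0.
  apply/existsP; apply: contraNT nz => /existsPn y0; apply/eqP/ffunP => w.
  by rewrite ffunE; apply/eqP; have := y0 w; rewrite negbK.
case: (@arg_minnP _ w0 (fun w => y w != 0) (fun w => edeg (expo_of w)) nz0) => w nzw min_w.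
have [|m def_top] := @expo_subK _ (top_expo q n) (expo_of w).
  by move=> i; rewrite !ffunE; have /forallP/(_ i) := valid_expo_of w; rewrite !ffunE.
exists w, m; split => //; exists (y w * (-1) ^+ inv2 (expo_of w).2 m.2).
  by rewrite mulf_neq0 ?signr_eq0.
rewrite {1}(formE y) mulr_suml (bigD1 w) //= big1 ?addr0 => [|w' nw'w].
  by rewrite -scalerAl deltaM scalerA -def_top.
rewrite -scalerAl deltaM scalerA; have [->|nzw'] := eqVneq (y w') 0.
  by rewrite mul0r scale0r.
(* If w' + m is admissible, it lies below the top exponent w + m, so w' divides w; minimality of the
   degree of w forces equality. *)
rewrite delta_invalid ?scaler0 //; apply: contraNN nw'w => vw'; apply/eqP.
have le_w'w i : ((expo_of w').1 i <= (expo_of w).1 i)%N && ((expo_of w').2 i <= (expo_of w).2 i)%N.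
  have /forallP/(_ i) := vw'.
  have := congr1 (fun e : expo n => e.1 i) def_top; have := congr1 (fun e : expo n => e.2 i) def_top.
  rewrite !ffunE => e2 e1 /andP[le1 le2]; apply/andP; split.
    by rewrite -(leq_add2r (m.1 i)); apply: leq_trans le1 (eq_leq e1).
  by rewrite -(leq_add2r (m.2 i)); apply: leq_trans le2 (eq_leq e2).
apply: (can_inj (@expo_ofK q n)).
have [m0 def_w] := expo_subK le_w'w.
have := min_w w' nzw'; rewrite def_w edegD -{2}[edeg _]addn0 leq_add2l leqn0 => /eqP m00.
suff -> : m0 = 0 by rewrite addr0.
move: m00; rewrite /edeg => /eqP; rewrite sum_nat_eq0 => /forallP m00.
case: m0 m00 {def_w} => a b /= m00; congr (_, _); apply/ffunP => i; rewrite ffunE;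
  by have := m00 i; rewrite addn_eq0 => /andP[/eqP ? /eqP].
Qed.

(** For even n the complement m of an odd monomial of y is odd. Odd forms anticommute, so the
    commutator of x + y with [delta m] is 2 y [delta m], a nonzero multiple of the top monomial,
    which [rho] does not kill. *)
Lemma odd_part_eq0 x y : ~~ odd n -> grade x = x -> grade y = - y ->
  (forall m, GRing.comm (rho (x + y)) (rho (delta m))) -> y = 0.
Proof.
move=> ev_n evx ody rho_comm; apply/eqP; apply: contraT => nzy.
have [w [m [nzw def_top [c nzc def_ym]]]] := exists_complement nzy.
have od_m : odd (bdeg m).
  have := congr1 (@bdeg n) def_top; rewrite bdegD.
  have -> : bdeg (top_expo q n) = n.
    rewrite /bdeg (eq_bigr (fun=> 1%N)) => [|i _]; last by rewrite !ffunE.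
    by rewrite sum_nat_const card_ord muln1.
  move/(congr1 odd); rewrite oddD (negbTE ev_n) (odd_coef char_k q_gt1 ody nzw).
  by case: (odd (bdeg m)).
have od_dm : grade (delta m) = - delta m by rewrite grade_delta -signr_odd od_m expr1 scaleN1r.
have my : delta m * y = - (y * delta m) by rewrite (odd_grade _ ody) od_dm mulNr opprK.
have two_ym : (x + y) * delta m - delta m * (x + y) = (2%:R * c) *: delta (top_expo q n).
  rewrite mulrDl mulrDr my (even_central _ evx) opprD addrACA subrr add0r opprK.
  by rewrite -mulr2n -scaler_nat def_ym scalerA.
have rho_c : rho ((x + y) * delta m) = rho (delta m * (x + y)).
  rewrite (to_grassmannM char_k q_gt1 (x + y)) (to_grassmannM char_k q_gt1 _ (x + y)).
  exact: rho_comm.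
have : rho ((2%:R * c) *: delta (top_expo q n)) = 0.
  by rewrite -two_ym linearB /= rho_c subrr.
rewrite linearZ => /eqP; rewrite scaler_eq0 mulf_eq0.
rewrite (negbTE (two_neq0 char_k q_gt1)) (negbTE nzc) /=.
by rewrite (negbTE (to_grassmann_top_neq0 n char_k q_gt1)).
Qed.

End Socle.

(** * Central elements in algebras with central commutators *)

Section LieNilpotent.
Variables (k : fieldType) (T : algType k).
Hypotheses (two0 : 2%:R != 0 :> k) (nilT : lie_nilpotent2 T).
Implicit Types x y z : T.

Lemma comm_half x y : GRing.comm (x *+ 2) y -> GRing.comm x y.
Proof.
by rewrite /GRing.comm -scaler_nat -scalerAl -scalerAr => /(scalerI two0).
Qed.

(** The commutator [x^2, y] = 2x[x, y] is central, hence so is x[x, y]. Commuting it with z, while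
    [x, y] is itself central, leaves [x, z][x, y] = 0. *)
Lemma mul_commutator0 x y z : (x * z - z * x) * (x * y - y * x) = 0.
Proof.
have cb := nilT x y; set b := x * y - y * x in cb *.
have : GRing.comm (x * b) z.
  apply: comm_half; rewrite mulr2n -{2}cb.
  have -> : x * b + b * x = (x * x) * y - y * (x * x); last exact: nilT.
  by rewrite /b mulrBr mulrBl !mulrA addrA subrK.
rewrite /GRing.comm -mulrA cb !mulrA => /eqP; rewrite -subr_eq0 -mulrBl => /eqP.
by [].
Qed.

(** Moving z past a factor x costs [x, z], which annihilates [x, y]. *)
Lemma comm_exp_commutator x y z r : GRing.comm (x ^+ r * (x * y - y * x)) z.
Proof.
have cb := nilT x y; elim: r => [|r IHr]; first by rewrite expr0 mul1r; apply: cb.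
rewrite exprS -mulrA; set w := x ^+ r * _ in IHr *.
have zx : z * x = x * z - (x * z - z * x) by rewrite subKr.
have xz0 : (x * z - z * x) * w = 0.
  by rewrite /w mulrA (nilT x z) -mulrA mul_commutator0 mulr0.
clearbody w; rewrite /GRing.comm [RHS]mulrA zx mulrBl xz0 subr0 -!mulrA.
by rewrite IHr.
Qed.

Definition power_commutator q x y := x ^+ q * (x * y - y * x) * y ^+ q.

Lemma power_commutator_central q x y z : GRing.comm (power_commutator q x y) z.
Proof.
rewrite /power_commutator; elim: {2}q => [|r IHr].
  by rewrite expr0 mulr1; apply: comm_exp_commutator.
rewrite exprSr mulrA; set w := _ * y ^+ r in IHr *.
have yz : y * z = z * y + (y * z - z * y) by rewrite addrC subrK.
have yz0 : w * (y * z - z * y) = 0.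
  rewrite /w -mulrA -(nilT y z) mulrA -[x ^+ q * _ * _]mulrA.
  by rewrite -[x * y - y * x]opprB mulNr mul_commutator0 oppr0 mulr0 mul0r.
clearbody w; rewrite /GRing.comm -[LHS]mulrA {1}yz mulrDr yz0 addr0 [LHS]mulrA.
by rewrite IHr -mulrA.
Qed.

End LieNilpotent.

(** * Central polynomials of the Grassmann algebra *)

Section GenericElements.
Variables (k : fieldType) (q n : nat).
Hypotheses (char_k : q.+1 \in [pchar k]) (q_gt1 : (1 < q)%N).
Local Notation dform := (dform k q n).
Local Notation rho := (@to_grassmann k q n).

(** The default 0 discards the variables beyond the first n, so every polynomial can be
    evaluated. *)
Definition generic (i : nat) : dform :=
  if insub i is Some o then fa k q o + fb k q o else 0.

Lemma generic_ord (o : 'I_n) : generic o = fa k q o + fb k q o.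
Proof. by rewrite /generic valK. Qed.

Lemma generic_eval_fedosov (t : nat -> dform) f :
  (forall i, fedosov (t i)) -> fedosov (free_eval t f).
Proof.
move=> ft; elim/freeAlg_ind: f => [|a f g IHf IHg|i|f g IHf IHg].
- by rewrite linear0; apply: fedosov0.
- by rewrite free_eval_linear; apply: fedosovP.
- by rewrite free_eval_varX.
- by rewrite free_evalM; apply: fedosovM.
Qed.

Lemma fedosov_generic i : fedosov (generic i).
Proof.
by rewrite /generic; case: insub => [o|]; [apply: fedosov_gen | apply: fedosov0].
Qed.

Definition eval_grassmann (f : freeAlg k) : grassmann0 k := (rho (free_eval generic f)).2.

Lemma rho_generic_fst f : (rho (free_eval generic f)).1 = 0.
Proof.
elim/freeAlg_ind: f => [|a f g IHf IHg|i|f g IHf IHg].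
- by rewrite (linear0 (free_eval generic)) (linear0 rho).
- by rewrite free_eval_linear to_grassmann_linear; apply: fst_eq0P.
- rewrite free_eval_varX /generic; case: insub => [o|]; last by rewrite (linear0 rho).
  rewrite to_grassmannD to_grassmann_fa // to_grassmann_fb //.
  rewrite /odd_gen gG.unlock; apply: fst_eq0D => //.
  apply: (big_ind (fun x : unitized (grassmann0 k) => x.1 = 0)) => [//|x y x0 y0|s _].
    exact: fst_eq0D.
  by rewrite gG.unlock; apply: fst_eq0M.
by rewrite free_evalM to_grassmannM //; apply: fst_eq0M.
Qed.

Lemma inU_eval_grassmann f : inU (eval_grassmann f) = rho (free_eval generic f).
Proof. exact/inU_snd/rho_generic_fst. Qed.

Lemma eval_grassmann_hom : alg_hom eval_grassmann.
Proof.
split=> [c f g|f g]; apply: inU_inj.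
  rewrite inU_eval_grassmann free_eval_linear to_grassmann_linear.
  by rewrite -!inU_eval_grassmann -inU_linear.
by rewrite inU_eval_grassmann free_evalM to_grassmannM // -!inU_eval_grassmann -inU_M.
Qed.

End GenericElements.

(** * T-spaces and evaluation along endomorphisms *)

Section TSpaceTheory.
Variable k : fieldType.
Local Notation F := (freeAlg k).

Lemma alg_hom_comp (A B C : nonUnitalAlgType k) (f : B -> C) (g : A -> B) :
  alg_hom f -> alg_hom g -> alg_hom (f \o g).
Proof.
by case=> fL fM [gL gM]; split=> [c x y|x y] /=; rewrite ?gL ?fL ?gM ?fM.
Qed.

Lemma alg_hom0 (A B : nonUnitalAlgType k) (f : A -> B) : alg_hom f -> f 0 = 0.
Proof. by case=> fL _; have := fL (- 1) 0 0; rewrite scaler0 addr0 scaleN1r addNr. Qed.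

Lemma T_space_gen_T_space (H : F -> Prop) : T_space (T_space_gen H).
Proof.
split=> [S [] //|a f g Sf Sg S TS HS|phi phiH f Sf S TS HS].
  by case: (TS) => _ SD _; apply: SD; [apply: Sf | apply: Sg].
by case: (TS) => _ _ SH; apply: SH => //; apply: Sf.
Qed.

(** Polynomials all of whose values are central form a T-space containing the central
    polynomials. *)
Lemma CP_central (A : nonUnitalAlgType k) f : CP A f ->
  forall phi : F -> A, alg_hom phi -> central (phi f).
Proof.
move=> CPf; apply: (CPf (fun f => forall phi : F -> A, alg_hom phi -> central (phi f))).
  split=> [phi phiH x|a g h IHg IHh phi phiH x|psi psiH g IHg phi phiH].
  - by rewrite alg_hom0 // nmul0l nmul0r.
  - have [phiL _] := phiH.
    by rewrite phiL nmul_linearl nmul_linearr IHg // IHh.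
  exact: IHg (alg_hom_comp phiH psiH).
by move=> h [].
Qed.

Lemma free_eval_hom (T : algType k) (t : nat -> T) (phi : F -> F) f : alg_hom phi ->
  free_eval t (phi f) = free_eval (fun i => free_eval t (phi (varX k i))) f.
Proof.
case=> phiL phiM.
apply: (free_eval_unique (h := fun f => free_eval t (phi f))) => [c x y|x y|||i].
- by rewrite phiL free_eval_linear.
- by rewrite phiM free_evalM.
- exact: free_eval_linear.
- exact: free_evalM.
by rewrite free_eval_varX.
Qed.

Lemma exists_var_bound (H : seq F) : exists m, forall h, h \in H ->
  forall (w : word) i, w \in msupp h -> i \in val w -> (i < m)%N.
Proof.
exists (\max_(h <- H) \max_(w <- msupp h) \max_(i <- val w) i.+1)%N => h hH w i wh iw.
apply: leq_trans (@leq_bigmax_seq _ _ _ (fun h => \max_(w <- msupp h) \max_(i <- val w) i.+1)%N h hH isT).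
apply: leq_trans (@leq_bigmax_seq _ _ _ (fun w : word => \max_(i <- val w) i.+1)%N w wh isT).
exact: (@leq_bigmax_seq _ _ _ (fun i => i.+1) i iw isT).
Qed.

End TSpaceTheory.

(** * The central polynomial with nonzero top coefficient *)

Section CentralElement.
Variables (k : fieldType) (q N : nat).
Hypotheses (char_k : q.+1 \in [pchar k]) (q_gt1 : (1 < q)%N) (N_gt0 : (0 < N)%N).
Local Notation F := (freeAlg k).

Definition unitized_witness : unitized F :=
  \prod_(i < N) power_commutator q (inU (varX k i.*2)) (inU (varX k i.*2.+1)).
Definition witness : F := unitized_witness.2.

(** As N > 0 there is a first factor, and it begins with a positive power of a variable; hence the
    product has no constant term. *)
Lemma inU_witness : inU witness = unitized_witness.
Proof.
apply: inU_snd; rewrite /unitized_witness; case: N N_gt0 => // r _.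
rewrite big_ord_recl /power_commutator !fst_unitizedM fst_unitizedX /=.
by rewrite -[q](prednK (ltnW q_gt1)) exprS !mul0r.
Qed.

Lemma witness_map (T : algType k) (phi : F -> T) : linear phi ->
    (forall f g, phi (nmul f g) = phi f * phi g) ->
  phi witness = \prod_(i < N) power_commutator q (phi (varX k i.*2)) (phi (varX k i.*2.+1)).
Proof.
move=> phiL phiM; rewrite -(unitized_map_inU phi) inU_witness.
have [m1 mM] := unitized_map_monoid phiL phiM.
have mB x y : unitized_map phi (x - y) = unitized_map phi x - unitized_map phi y.
  have := unitized_map_linear phiL (- 1) y x.
  by rewrite scaleN1r scaleN1r [- y + x]addrC [RHS]addrC.
have mX x r : unitized_map phi (x ^+ r) = unitized_map phi x ^+ r.
  by elim: r => [|r IHr]; rewrite ?expr0 // !exprS mM IHr.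
rewrite /unitized_witness (big_morph _ mM m1); apply: eq_bigr => i _.
by rewrite /power_commutator !(mM, mB, mX) !unitized_map_inU.
Qed.

Lemma witness_central (phi : F -> grassmann0 k) : alg_hom phi -> central (phi witness).
Proof.
case=> phiL phiM a; apply: inU_inj; rewrite !inU_M.
rewrite (@witness_map (unitized (grassmann0 k)) (fun f => inU (phi f))) => [|c f g|f g].
- apply: commr_sym; apply: commr_prod => i _; apply: commr_sym.
  apply: power_commutator_central; first exact: two_neq0 char_k q_gt1.
  exact: unitized_grassmann_nilpotent.
- by rewrite phiL inU_linear.
by rewrite phiM inU_M.
Qed.

(** The commutator equals 2 b_i b_j, and b_i^2 = b_j^2 = 0 strips the [b]-parts from the adjacent
    powers. *)
Lemma power_commutator_generators m (i j : 'I_m) :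
  power_commutator q (fa k q i + fb k q i) (fa k q j + fb k q j)
    = (fa k q i ^+ q * fb k q i) * (fa k q j ^+ q * fb k q j) *+ 2.
Proof.
set a := fa k q i; set b := fb k q i; set a' := fa k q j; set b' := fb k q j.
have [ca ca'] : (forall z, a * z = z * a) /\ (forall z, a' * z = z * a').
  by split=> z; apply: fa_central.
have [bb bb'] : b * b = 0 /\ b' * b' = 0 by split; apply: fb_sqr.
have b'b : b' * b = - (b * b') by apply: fb_anticomm.
have xb r : (a + b) ^+ r * b = a ^+ r * b.
  elim: r => [|r IHr]; first by rewrite !expr0.
  rewrite exprS -mulrA IHr mulrDl exprS -mulrA; suff -> : b * (a ^+ r * b) = 0 by rewrite addr0.
  have : GRing.comm b (a ^+ r) by apply/commrX/commr_sym/ca.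
  by rewrite mulrA => ->; rewrite -mulrA bb mulr0.
have b'y r : b' * (a' + b') ^+ r = a' ^+ r * b'.
  elim: r => [|r IHr]; first by rewrite !expr0 mul1r mulr1.
  by rewrite exprSr mulrA IHr mulrDr -!mulrA bb' mulr0 addr0 -ca' mulrA -exprSr.
rewrite /power_commutator.
have -> : (a + b) * (a' + b') - (a' + b') * (a + b) = (b * b') *+ 2.
  rewrite mulrDl [in X in _ - X]mulrDr ca opprD addrACA subrr add0r.
  by rewrite mulrDr mulrDl b'b ca' opprD addrACA subrr add0r opprK -mulr2n.
by rewrite mulrnAr mulrnAl [_ ^+ q * (b * b')]mulrA xb -[a ^+ q * b * b' * _]mulrA b'y.
Qed.

Lemma generic_witness :
  free_eval (generic k q N.*2) witness = delta k q (top_expo q N.*2) *+ 2 ^ N.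
Proof.
rewrite (witness_map (free_eval_linear _) (free_evalM _)) delta_prod.
(* Extended by 0 to all naturals, because [prod_double] pairs factors indexed by naturals. *)
pose g (i : nat) : dform k q N.*2 :=
  if insub i is Some o then fa k q o ^+ q * fb k q o else 0.
have -> : \prod_(i < N.*2) (fa k q i ^+ (top_expo q N.*2).1 i * fb k q i ^+ (top_expo q N.*2).2 i)
    = \prod_(i < N) (g i.*2 * g i.*2.+1).
  apply: etrans (esym (prod_double g 0 N)).
  by apply: eq_bigr => i _; rewrite !ffunE /g add0n valK expr1.
rewrite -[X in _ *+ 2 ^ X]card_ord -prodrMn_const; apply: eq_bigr => i _.
rewrite !free_eval_varX.
have lt0 : (i.*2 < N.*2)%N by rewrite ltn_double.
have lt1 : (i.*2.+1 < N.*2)%N by rewrite ltn_Sdouble.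
rewrite -[i.*2]/(val (Ordinal lt0)) -[i.*2.+1]/(val (Ordinal lt1)).
by rewrite !generic_ord /g !valK power_commutator_generators.
Qed.

(** The witness is not an identity: generic evaluation followed by the map to G_0 gives 2^N times
    the nonzero image of the top monomial. *)
Lemma witness_CP : CP (grassmann0 k) witness.
Proof.
move=> S _; apply; split; last by move=> phi; apply: witness_central.
move=> /(_ _ (eval_grassmann_hom N.*2 char_k q_gt1)) /(congr1 (@inU _ _)).
rewrite inU_eval_grassmann // generic_witness -scaler_nat linearZ (linear0 (@inU _ _)).
move/eqP; rewrite scaler_eq0 (negbTE (to_grassmann_top_neq0 N.*2 char_k q_gt1)) orbF.
by rewrite natrX expf_eq0 (negbTE (two_neq0 char_k q_gt1)) andbF.
Qed.

End CentralElement.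

(** * Members of [CP] in few variables *)

Section FewVariables.
Variables (k : fieldType) (q m n : nat).
Hypotheses (char_k : q.+1 \in [pchar k]) (q_gt1 : (1 < q)%N).
Hypotheses (ev_m : ~~ odd m) (lt_mn : (m < n)%N).
Local Notation F := (freeAlg k).

(** The value is w + dw with dw its odd part, and centrality of its image in G_0 forces dw = 0. *)
Lemma CP_closed_form f : CP (grassmann0 k) f ->
  dd (free_eval (generic k q m) f) = 0 /\
  grade (free_eval (generic k q m) f) = free_eval (generic k q m) f.
Proof.
move=> CPf; have [w [evw _ def_f]] := generic_eval_fedosov char_k f (fedosov_generic m char_k).
have od_dw : grade (dd w) = - dd w by rewrite grade_dd // evw.
suff dw0 : dd w = 0 by rewrite def_f dw0 addr0.
apply: (odd_part_eq0 char_k q_gt1 ev_m evw od_dw) => m0.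
rewrite -def_f -(inU_eval_grassmann m char_k q_gt1); apply: inU_comm.
exact: (CP_central CPf (eval_grassmann_hom m char_k q_gt1)).
Qed.

Lemma few_variables_top f (phi : F -> F) : alg_hom phi -> CP (grassmann0 k) f ->
    (forall (w : word) i, w \in msupp f -> i \in val w -> (i < m)%N) ->
  free_eval (generic k q n) (phi f) (top_mono q n) = 0.
Proof.
move=> phiH CPf lt_m; rewrite free_eval_hom //.
pose t i := free_eval (generic k q n) (phi (varX k i)).
have ft i : fedosov (t i) := generic_eval_fedosov char_k _ (fedosov_generic n char_k).
(* As [phi] sends x_i to an element of value u_i + du_i, evaluating [phi f] means substituting the
   u_i into the closed form attached to [f] in m variables. *)
have /fin_all_exists[u uP] (i : 'I_m) : exists u, [/\ grade u = u, aug u = 0 & t i = u + dd u] := ft i.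
have u_even i : grade (u i) = u i by case: (uP i).
have u_aug i : aug (u i) = 0 by case: (uP i).
have -> : free_eval t f = form_map u (free_eval (generic k q m) f).
  rewrite (eq_in_free_eval (t' := fun i => form_map u (generic k q m i))) => [|w i wf iw].
    apply: (free_eval_unique (h' := fun f => form_map u (free_eval (generic k q m) f)))
      => [|||x y|i].
    - exact: free_eval_linear.
    - exact: free_evalM.
    - by move=> c x y; rewrite free_eval_linear form_map_linear.
    - by rewrite free_evalM form_mapM.
    by rewrite !free_eval_varX.
  have lt_im := lt_m w i wf iw; rewrite -[i]/(val (Ordinal lt_im)) generic_ord.
  rewrite linearD /= form_map_fa // form_map_fb //.
  by case: (uP (Ordinal lt_im)).
by apply: (closed_map_top char_k q_gt1) => //; case: (CP_closed_form CPf).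
Qed.

End FewVariables.

Theorem theorem2p2 (p : nat) (p_prime : prime p) (p_gt2 : (2 < p)%N)
    (k : fieldType) (char_k : p \in [pchar k]%R) :
  ~ finitely_based (CP (grassmann0 k)).
Proof.
case: p p_prime p_gt2 char_k => // q _ q_gt1 char_k [H genH].
have [b bound_b] := exists_var_bound H.
(* The generators, with variables below b, are evaluated in 2b variables, an even number as
   [odd_part_eq0] demands; n is the next even number. *)
pose n := b.+1.*2.
(* Quantifying over all [phi] makes [S] stable under endomorphisms by composition. *)
pose S f := CP (grassmann0 k) f /\ forall phi : freeAlg k -> freeAlg k, alg_hom phi ->
  free_eval (generic k q n) (phi f) (top_mono q n) = 0.
have TS : T_space S.
  have [CP0 CPD CPH] := T_space_gen_T_space (@central_polynomial k (grassmann0 k)).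
  split=> [|a f g [CPf Sf] [CPg Sg]|psi psiH f [CPf Sf]].
  - split=> // phi phiH; rewrite (alg_hom0 phiH).
    by rewrite (linear0 (free_eval (generic k q n))) ffunE.
  - split=> [|phi phiH]; first exact: CPD.
    by rewrite (phiH.1 a f g) free_eval_linear dform_coefP Sf // Sg // mulr0 addr0.
  split=> [|phi phiH]; first exact: CPH.
  exact: (Sf _ (alg_hom_comp phiH psiH)).
have HS h : h \in H -> S h.
  move=> hH; have CPh : CP (grassmann0 k) h by apply/genH => S' _; apply.
  split=> // phi phiH.
  apply: (few_variables_top (m := b.*2)) => //; first by rewrite odd_double.
  move=> w i wh iw; apply: leq_trans (bound_b h hH w i wh iw) _.
  by rewrite -addnn leq_addr.
have CPw : CP (grassmann0 k) (witness k q b.+1) by apply: witness_CP.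
have [_ topS] : S (witness k q b.+1) by apply: (genH _).1 CPw _ TS HS.
have id_hom : alg_hom (id : freeAlg k -> freeAlg k) by split.
have := topS _ id_hom.
(* The top coefficient of the witness itself is 2^(b+1), which is nonzero in k. *)
rewrite generic_witness // -/n -scaler_nat -[_ *: _]addr0 dform_coefP ffunE expo_of_top eqxx.
rewrite ffunE addr0 mulr1 natrX => /eqP.
by rewrite expf_eq0 (negbTE (two_neq0 char_k q_gt1)) andbF.
Qed.
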